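(* Let $\mathcal W$ be a class of $\infty$-functors satisfying the following properties: (a) $\mathcal W$ contains the identities and satisfies the two-out-of-three property; (b) every strong retract by oplax transformation (left as well as right) is in $\mathcal W$; (c) $\mathcal W$ satisfies a Theorem A for commutative triangles: for all $\infty$-functors $u:A\to B$, $v:A\to C$, $w:B\to C$ with $wu=v$, if for every object $c$ of $C$ the $\infty$-functor $c\backslash A\to c\backslash B$ induced by $u$ is in $\mathcal W$, then $u$ is in $\mathcal W$. Then $\mathcal W$ satisfies a Theorem A for $2$-triangles: for all $\infty$-functors $u:A\to B$, $v:A\to C$, $w:B\to C$ and every oplax transformation $\alpha:v\Rightarrow wu$, if for every object $c$ of $C$ the $\infty$-functor $c\backslash(u,\alpha):c\backslash A\to c\backslash B$ is in $\mathcal W$, then $u$ is in $\mathcal W$.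
   Context: All $\infty$-categories and $\infty$-functors are strict; $\infty\text{-}\mathrm{Cat}$ is their category. $D_i$ is the $\infty$-category corepresenting $C \mapsto \{i\text{-cells of } C\}$; $\sigma,\tau : D_{i-1}\to D_i$ correspond to the source and target of the principal $i$-cell of $D_i$. Steiner complexes. An augmented directed complex is a chain complex $K$ of abelian groups in degrees $\ge 0$ with an augmentation $e:K_0\to\mathbb Z$ ($e d_1=0$) and submonoids $K_i^*\subset K_i$; morphisms preserve $d$, $e$ and the submonoids. The functor $\lambda$ sends an $\infty$-category $C$ to the complex with $\lambda(C)_i$ generated by $[x]$, $x$ an $i$-cell, subject to $[x*_j y]=[x]+[y]$, positivity submonoids generated by the $[x]$, $d[x]=[t(x)]-[s(x)]$, $e[x]=1$. It has a right adjoint $\nu$: the $i$-cells of $\nu(K)$ are the tables $(x_k^\epsilon)_{0\le k\le i,\ \epsilon=0,1}$ with $x^\epsilon_k\in K_k^*$, $d(x_k^\epsilon)=x_{k-1}^1-x_{k-1}^0$, $e(x_0^\epsilon)=1$, $x_i^0=x_i^1$. A basis of $K$ is a graded set $(B_i)$ with $B_i$ a $\mathbb Z$-basis of $K_i$ generating the monoid $K_i^*$. Given a basis, write $x=x_+-x_-$ with $x_\pm$ positive with disjoint supports, and for $b\in B_i$ put $\langle b\rangle_i^\epsilon=b$, $\langle b\rangle_{k-1}^0=d(\langle b\rangle_k^0)_-$, $\langle b\rangle_{k-1}^1=d(\langle b\rangle_k^1)_+$. The basis is unital if $e(\langle b\rangle_0^\epsilon)=1$ for all $b,\epsilon$; it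 is strongly loop-free if the smallest preorder $\le_{\mathbb N}$ on $\coprod B_i$ with $y\le_{\mathbb N} x\le_{\mathbb N} z$ whenever $x\in B_i$ ($i\ge1$), $y\in\mathrm{supp}\,d(x)_-$, $z\in\mathrm{supp}\,d(x)_+$, is an order. A strong Steiner complex is an augmented directed complex having a unital strongly loop-free basis. Gray tensor product. $K\otimes L$ is the usual tensor product of complexes, $d(x\otimes y)=dx\otimes y+(-1)^{|x|}x\otimes dy$, $e(x\otimes y)=e(x)e(y)$, with positivity submonoids generated by the $x\otimes y$ with $x,y$ positive. The Gray tensor product $\otimes$ on $\infty\text{-}\mathrm{Cat}$ is the unique (up to unique monoidal isomorphism) biclosed monoidal structure for which $\nu$ restricted to strong Steiner complexes is monoidal; its unit is $D_0$. $\underline{\mathrm{Hom}}_{\mathrm{oplax}}$ and $\underline{\mathrm{Hom}}_{\mathrm{lax}}$ are defined by $\mathrm{Hom}(A\otimes B,C)\simeq\mathrm{Hom}(A,\underline{\mathrm{Hom}}_{\mathrm{oplax}}(B,C))\simeq\mathrm{Hom}(B,\underline{\mathrm{Hom}}_{\mathrm{lax}}(A,C))$. Oplax transformations. For $u,v:A\to B$, an oplax transformation $\alpha:u\Rightarrow v$ is an $\infty$-functor $\alpha:D_1\otimes A\to B$ with $\alpha(\sigma\otimes A)=u$ and $\alpha(\tau\otimes A)=v$, i.e. a $1$-cell $u\to v$ of $\underline{\mathrm{Hom}}_{\mathrm{oplax}}(A,B)$; vertical composition (juxtaposition) and identities $1_u$ are those of $1$-cells there. For $y:T\to A$, $\alpha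 * y=\alpha(D_1\otimes y)$. Strong retracts. An $\infty$-functor $i:A\to B$ is a strong left (resp. right) retract by oplax transformation if there exist $r:B\to A$ with $ri=1_A$ and an oplax transformation $\alpha:ir\Rightarrow 1_B$ (resp. $\alpha:1_B\Rightarrow ir$) with $\alpha*i=1_i$. Slices. For $v:A\to C$ and an object $c$ of $C$, $c\backslash A = D_0\times_C\underline{\mathrm{Hom}}_{\mathrm{lax}}(D_1,C)\times_C A$ (limit of $D_0\xrightarrow{c}C\xleftarrow{\pi_0}\underline{\mathrm{Hom}}_{\mathrm{lax}}(D_1,C)\xrightarrow{\pi_1}C\xleftarrow{v}A$, with $\pi_0,\pi_1$ induced by $\sigma,\tau:D_0\to D_1$). Thus an $\infty$-functor $T\to c\backslash A$ is a pair $(y,\lambda)$ with $y:T\to A$ an $\infty$-functor and $\lambda: c_T\Rightarrow vy$ an oplax transformation, $c_T:T\to C$ being constant at $c$. (This agrees, up to canonical isomorphism, with the slice defined from the $\infty$-categorical join.) If $wu=v$, the induced $\infty$-functor $c\backslash A\to c\backslash B$ sends $(y,\lambda)$ to $(uy,\lambda)$. For $\alpha:v\Rightarrow wu$, the $\infty$-functor $c\backslash(u,\alpha):c\backslash A\to c\backslash B$ is the one sending, naturally in $T$, $(y,\lambda)$ to $(uy,(\alpha*y)\lambda)$. *)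

(* Defs.v *)
From HB Require Import structures.
From mathcomp Require Import all_boot all_order all_algebra.
From mathcomp Require Import finmap boolp zify.
From Stdlib Require Import Relation_Operators.

Set Implicit Arguments.
Unset Strict Implicit.
Unset Printing Implicit Defensive.

Import Order.TTheory GRing.Theory Num.Theory.

(* A reflexive globular set.  [bd e j x], for an [i]-cell [x], is the iterated
   source ([e = false]) or target ([e = true]) of [x] when [j <= i], and the
   iterated identity of [x] when [i <= j]. *)
Record globSet := GlobSet {
  cell :> nat -> Type;
  bd : bool -> forall i j, cell i -> cell j;
  bd_id : forall e i (x : cell i), bd e i x = x;
  bd_up : forall e e' i j (x : cell i), (i <= j)%N -> bd e j x = bd e' j x;
  bd_bd : forall e e' i j k (x : cell i), (i <= j)%N || (k < j)%N ->
    bd e' k (bd e j x) = bd e' k x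
}.
Arguments bd {g} e {i} j x.

Definition composable (X : globSet) (j i : nat) (x y : X i) : Prop :=
  (j < i)%N /\ bd false j x = bd true j y.
Arguments composable {X} j {i} x y.

(* [comp h] is [x *_j y]. In [bd_comp], the case [k < i] says that iterated
   sources and targets are compatible with composition, the case [i <= k] that
   identities are. *)
Record ooCat := OoCat {
  glob :> globSet;
  comp : forall (j i : nat) (x y : glob i), composable j x y -> glob i;
  src_comp : forall j i (x y : glob i) (h : composable j x y),
    bd false j (comp h) = bd false j y;
  tgt_comp : forall j i (x y : glob i) (h : composable j x y),
    bd true j (comp h) = bd true j x;
  bd_comp : forall e j k i (x y : glob i) (h : composable j x y)
      (h' : composable j (bd e k x) (bd e k y)),
    bd e k (comp h) = comp h';
  comp_idr : forall e j i (x : glob i)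
      (h : composable j x (bd e i (bd false j x))),
    comp h = x;
  comp_idl : forall e j i (x : glob i)
      (h : composable j (bd e i (bd true j x)) x),
    comp h = x;
  compA : forall j i (x y z : glob i)
      (hxy : composable j x y) (hyz : composable j y z)
      (h1 : composable j (comp hxy) z) (h2 : composable j x (comp hyz)),
    comp h1 = comp h2;
  interchange : forall j k i (x y z w : glob i), (j < k)%N -> forall
      (hxy : composable k x y) (hzw : composable k z w)
      (h1 : composable j (comp hxy) (comp hzw))
      (hxz : composable j x z) (hyw : composable j y w)
      (h2 : composable k (comp hxz) (comp hyw)),
    comp h1 = comp h2
}.

Lemma comp_congr (C : ooCat) j i (x y x' y' : C i)
    (h : composable j x y) (h' : composable j x' y') :
  x = x' -> y = y' -> comp h = comp h'.
Proof.
by move=> ex ey; case: _ / ex h' => h'; case: _ / ey h' => h'; congr comp.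
Qed.

Record ooFun (A B : ooCat) := OoFun {
  fcell :> forall i, A i -> B i;
  fun_bd : forall e i j (x : A i), fcell (bd e j x) = bd e j (fcell x);
  fun_comp : forall j i (x y : A i) (h : composable j x y)
      (h' : composable j (fcell x) (fcell y)),
    fcell (comp h) = comp h'
}.

Lemma ooFun_ext (A B : ooCat) (F G : ooFun A B) :
  (forall i x, F i x = G i x) -> F = G.
Proof.
case: F G => [F Fb Fc] [G Gb Gc] /= FG.
have E : F = G by apply: functional_extensionality_dep => i; apply/funext/FG.
by case: _ / E Gb Gc {FG} => Gb Gc; congr OoFun; apply: Prop_irrelevance.
Qed.

Lemma fun_composable (A B : ooCat) (F : ooFun A B) j i (x y : A i) :
  composable j x y -> composable j (F i x) (F i y).
Proof. by case=> ? e; split=> //; rewrite -!fun_bd e. Qed.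

Definition fid (A : ooCat) : ooFun A A.
Proof.
exists (fun i (x : A i) => x) => // j i x y h h'.
exact: comp_congr.
Defined.

Definition fcomp (A B C : ooCat) (G : ooFun B C) (F : ooFun A B) : ooFun A C.
Proof.
exists (fun i x => G i (F i x)).
- by move=> e i j x; rewrite !fun_bd.
- move=> j i x y h h'.
  by rewrite (fun_comp h (fun_composable F h)) (fun_comp _ h').
Defined.

Declare Scope oocat_scope.
Delimit Scope oocat_scope with oocat.
Local Open Scope oocat_scope.
Notation "G ∘ F" := (fcomp G F) (at level 40, left associativity) : oocat_scope.

Lemma fcompA A B C D (H : ooFun C D) (G : ooFun B C) (F : ooFun A B) :
  H ∘ (G ∘ F) = H ∘ G ∘ F.
Proof. exact: ooFun_ext. Qed.

Lemma fcompid A B (F : ooFun A B) : F ∘ fid A = F.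
Proof. exact: ooFun_ext. Qed.

Lemma fidcomp A B (F : ooFun A B) : fid B ∘ F = F.
Proof. exact: ooFun_ext. Qed.

Definition fcancel (A B : ooCat) (F : ooFun A B) (G : ooFun B A) : Prop :=
  G ∘ F = fid A /\ F ∘ G = fid B.

Section Disk.
Variable n : nat.

(* The [k]-cell [(m, e)] of [disk n] is the identity, in dimension [k], of the
   [m]-dimensional source or target of the principal cell when [m < n], and of
   the principal cell itself when [(m, e) = (n, false)]. *)
Definition disk_pred (k : nat) (p : nat * bool) : bool :=
  (p.1 <= k)%N && ((p.1 < n)%N || (p == (n, false))).

Definition disk_cell (k : nat) := {p : nat * bool | disk_pred k p}.

Lemma disk_bd_subproof e i j (x : disk_cell i) :
  disk_pred j (if ((val x).1 <= j)%N then val x else (j, e)).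
Proof.
case: x => [[m a] /= /andP[/= mi mn]].
case: leqP => [mj|jm]; rewrite /disk_pred /= ?mj ?leqnn //=.
by case/orP: mn => [/(ltn_trans jm)->//|/eqP[<- _]]; rewrite jm.
Qed.

Definition disk_bd e i j (x : disk_cell i) : disk_cell j :=
  exist (fun p => disk_pred j p) _ (disk_bd_subproof e j x).

Lemma disk_le i (x : disk_cell i) : ((val x).1 <= i)%N.
Proof. by case: x => p hp; case/andP: (hp). Qed.

Definition disk_glob : globSet.
Proof.
exists disk_cell disk_bd.
- by move=> e i x; apply: val_inj; rewrite /= disk_le.
- move=> e e' i j x ij; apply: val_inj => /=.
  by rewrite (leq_trans (disk_le x) ij).
- move=> e e' i j k x ijk; apply: val_inj => /=.
  case: (leqP (val x).1 j) => //= jx.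
  have kj : (k < j)%N.
    by case/orP: ijk => // ij; have := leq_trans (leq_trans jx (disk_le x)) ij; rewrite ltnn.
  by rewrite leqNgt kj /= leqNgt (ltn_trans kj jx).
Defined.

Definition disk_comp j i (x y : disk_glob i) (h : composable j x y) :
  disk_glob i := if (j < (val x).1)%N then x else y.

Lemma disk_composableP j i (x y : disk_glob i) : composable j x y ->
  [/\ (j < i)%N, (j < (val x).1)%N -> ((val y).1 <= j)%N /\ val y = (j, false) &
      ((val x).1 <= j)%N -> y = x \/ val x = (j, true) /\ (j < (val y).1)%N].
Proof.
move=> [ji /(congr1 val)] /=.
case: (leqP (val x).1 j) => xj; case: (leqP (val y).1 j) => yj exy;
  split=> //; rewrite ?(ltnNge _ (val x).1) ?xj //.
- by move=> _; left; apply: val_inj.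
- by move=> _; right.
Qed.

Definition disk : ooCat.
Proof.
exists disk_glob disk_comp.
- move=> j i x y h; have [ji xj yj] := disk_composableP h.
  rewrite /disk_comp; case: ltnP => // jx; have [yj' ey] := xj jx.
  by apply: val_inj; rewrite /= leqNgt jx yj' ey.
- move=> j i x y h; have [ji xj yj] := disk_composableP h.
  rewrite /disk_comp; case: ltnP => // jx; case: (yj jx) => [->//|[ex jy]].
  by apply: val_inj; rewrite /= jx ex leqNgt jy.
- move=> e j k i x y h h'; have [jk _] := h'; rewrite /disk_comp.
  have -> : (j < (val (disk_bd e k x)).1)%N = (j < (val x).1)%N.
    by rewrite /=; case: (leqP (val x).1 k) => //= xk; rewrite jk (ltn_trans jk xk).
  by case: (j < _)%N.
- move=> e j i x h; have [ji xj yj] := disk_composableP h.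
  rewrite /disk_comp; case: ltnP => // jx; case: (yj jx) => // -[ex].
  by rewrite /= jx (leq_trans jx (ltnW ji)) ltnNge jx.
- move=> e j i x h; have [ji xj yj] := disk_composableP h.
  rewrite /disk_comp; case: ltnP => // jx.
  have : ((val (disk_bd e i (disk_bd true j x))).1 <= j)%N.
    rewrite /=; case: (leqP (val x).1 j) => /= xj'; last by rewrite (ltnW ji).
    by rewrite (leq_trans xj' (ltnW ji)).
  by rewrite leqNgt jx.
- move=> j i x y z hxy hyz h1 h2; rewrite /disk_comp.
  by case jx: (j < (val x).1)%N; rewrite ?jx.
- move=> j k i x y z w jk hxy hzw h1 hxz hyw h2.
  have [ki xk yk] := disk_composableP hxy.
  rewrite /disk_comp.
  case kx: (k < (val x).1)%N; first by rewrite (ltn_trans jk kx) kx.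
  have [|->|[ex ky]] := yk; first by rewrite leqNgt kx.
    by case jx: (j < (val x).1)%N; rewrite ?kx.
  have jx : (j < (val x).1)%N by rewrite ex.
  by rewrite (ltn_trans jk ky) jx kx.
Defined.

Lemma disk_top_subproof : disk_pred n (n, false).
Proof. by rewrite /disk_pred leqnn eqxx orbT. Qed.

Definition disk_top : disk n :=
  exist (fun p => disk_pred n p) (n, false) disk_top_subproof.

End Disk.

(* The oo-functor [D_n -> C] corresponding to an [n]-cell of [C]. *)
Definition disk_map (C : ooCat) (n : nat) (x : C n) : ooFun (disk n) C.
Proof.
exists (fun k (p : disk n k) => bd false k (bd (val p).2 (val p).1 x)).
- move=> e i j [[m a] hm] /=; have /andP[/= mi mn] := hm.
  case: (leqP m j) => /= [mj|jm].
    by rewrite (@bd_bd _ false) ?mi //; apply: bd_up.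
  have le_mn : (m <= n)%N by case/orP: mn => [/ltnW//|/eqP[->]].
  by rewrite (@bd_bd _ false) ?mi // (@bd_bd _ a) ?jm ?orbT // bd_id.
- move=> j i [[m a] hm] [[m' a'] hm'] h h'.
  have [/= ji xj yj] := disk_composableP h.
  rewrite /= /disk_comp /=; case: ltnP => [jm|mj] /=.
    symmetry; have [_ [em ea]] := xj jm; subst m' a'.
    have /andP[/= mi mn] := hm; move: h' => /= h'.
    have e1 : bd false j x = bd false j (bd false i (bd a m x)).
      by rewrite bd_bd ?mi // bd_bd // jm orbT.
    have h2 : composable j (bd false i (bd a m x))
                (bd false i (bd false j (bd false i (bd a m x)))).
      by rewrite -e1.
    by rewrite -[RHS](comp_idr h2); apply: comp_congr; rewrite // e1.
  symmetry; case: (yj mj) => [[e1 e2]|[[e1 e2] jm']].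
    subst m' a'; move: h' => /= h'.
    have /andP[/= mi mn] := hm.
    have e1 : bd false i (bd a m x) =
              bd false i (bd true j (bd false i (bd a m x))).
      rewrite [bd true j _]bd_bd ?mi // (@bd_up _ true false) //.
      by rewrite [RHS]bd_bd // mj.
    have h2 : composable j (bd false i (bd true j (bd false i (bd a m x))))
                (bd false i (bd a m x)) by rewrite -e1.
    by rewrite -[RHS](comp_idl h2); apply: comp_congr.
  subst m a; move: h' => /= h'; have /andP[/= mi mn] := hm'.
  have e1 : bd true j x = bd true j (bd false i (bd a' m' x)).
    by rewrite bd_bd ?mi // bd_bd // jm' orbT.
  have h2 : composable j (bd false i (bd true j (bd false i (bd a' m' x))))
              (bd false i (bd a' m' x)) by rewrite -e1.
  by rewrite -[RHS](comp_idl h2); apply: comp_congr; rewrite // e1.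
Defined.

Lemma disk_map_top (C : ooCat) n (x : C n) : disk_map x n (disk_top n) = x.
Proof. by rewrite /= !bd_id. Qed.

Lemma disk_map_uniq (C : ooCat) n (F : ooFun (disk n) C) :
  F = disk_map (F n (disk_top n)).
Proof.
apply: ooFun_ext => i [[m a] hm] /=; rewrite -!fun_bd; congr (F i _).
have /andP[/= mi mn] := hm.
apply: val_inj => /=; case/orP: mn => [mn|/eqP[em ea]].
  by rewrite [(n <= m)%N]leqNgt mn /= mi.
by subst m a; rewrite leqnn /= mi.
Qed.

Definition globe_src n : ooFun (disk n) (disk n.+1) :=
  disk_map (bd false n (disk_top n.+1)).
Definition globe_tgt n : ooFun (disk n) (disk n.+1) :=
  disk_map (bd true n (disk_top n.+1)).

Definition to_disk0 (A : ooCat) : ooFun A (disk 0).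
Proof.
have sub k : disk_pred 0 k (0, false) by [].
have disk0P k (x y : disk 0 k) : x = y.
  apply: val_inj; case: x y => [[m a] h] [[m' a'] h'] /=.
  by case/andP: h h' => /= _ /eqP[-> ->] /andP[/= _ /eqP[-> ->]].
by exists (fun k _ => exist (fun p => disk_pred 0 k p) (0, false) (sub k)) => *; apply: disk0P.
Defined.

Lemma to_disk0_uniq A (F G : ooFun A (disk 0)) : F = G.
Proof.
apply: ooFun_ext => k x; apply: val_inj.
case: (F k x) (G k x) => [[m a] h] [[m' a'] h'] /=.
by case/andP: h h' => /= _ /eqP[-> ->] /andP[/= _ /eqP[-> ->]].
Qed.

Definition fconst (T C : ooCat) (c : C 0) : ooFun T C :=
  disk_map c ∘ to_disk0 T.

Section FibreProduct.
Variables (A B C : ooCat) (f : ooFun A C) (g : ooFun B C).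

Definition fib_cell i := {p : A i * B i | f i p.1 = g i p.2}.

Lemma fib_eq i (x y : fib_cell i) : sval x = sval y -> x = y.
Proof.
by case: x y => [p hp] [q hq] /= E; subst q; congr exist; apply: Prop_irrelevance.
Qed.

Lemma fib_bd_subproof e i j (x : fib_cell i) :
  f j (bd e j (sval x).1) = g j (bd e j (sval x).2).
Proof. by rewrite !fun_bd (svalP x). Qed.

Definition fib_glob : globSet.
Proof.
exists fib_cell (fun e i j x => exist _ (_, _) (fib_bd_subproof e j x)).
- by move=> e i [[x y] h]; apply: fib_eq; rewrite /= !bd_id.
- move=> e e' i j [[x y] h] ij; apply: fib_eq.
  by rewrite /= (bd_up e e' x ij) (bd_up e e' y ij).
- by move=> e e' i j k [[x y] h] ijk; apply: fib_eq; rewrite /= !bd_bd.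
Defined.

Lemma fib_composable1 j i (x y : fib_glob i) : composable j x y ->
  composable j (sval x).1 (sval y).1.
Proof. by case=> ji /(congr1 (fun z => (sval z).1)). Qed.

Lemma fib_composable2 j i (x y : fib_glob i) : composable j x y ->
  composable j (sval x).2 (sval y).2.
Proof. by case=> ji /(congr1 (fun z => (sval z).2)). Qed.

Lemma fib_comp_subproof j i (x y : fib_glob i) (h : composable j x y) :
  f i (comp (fib_composable1 h)) = g i (comp (fib_composable2 h)).
Proof.
rewrite (fun_comp _ (fun_composable f (fib_composable1 h))).
rewrite (fun_comp _ (fun_composable g (fib_composable2 h))).
by apply: comp_congr; [exact: (svalP x) | exact: (svalP y)].
Qed.

Definition fib_comp j i (x y : fib_glob i) (h : composable j x y) :
  fib_glob i := exist _ (_, _) (fib_comp_subproof h).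

Definition fibprod : ooCat.
Proof.
exists fib_glob fib_comp.
- by move=> *; apply: fib_eq; rewrite /= !src_comp.
- by move=> *; apply: fib_eq; rewrite /= !tgt_comp.
- move=> e j k i x y h h'; apply: fib_eq => /=.
  by congr pair; [exact: (bd_comp _ (fib_composable1 h')) |
                  exact: (bd_comp _ (fib_composable2 h'))].
- move=> e j i [[x y] hx] h; apply: fib_eq => /=.
  by congr pair; apply: (@comp_idr _ e).
- move=> e j i [[x y] hx] h; apply: fib_eq => /=.
  by congr pair; apply: (@comp_idl _ e).
- by move=> *; apply: fib_eq => /=; congr pair; apply: compA.
- by move=> *; apply: fib_eq => /=; congr pair; apply: interchange.
Defined.

Definition fib_fst : ooFun fibprod A.
Proof.
exists (fun i (x : fibprod i) => (sval x).1) => // j i x y h h' /=.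
exact: comp_congr.
Defined.

Definition fib_snd : ooFun fibprod B.
Proof.
exists (fun i (x : fibprod i) => (sval x).2) => // j i x y h h' /=.
exact: comp_congr.
Defined.

Lemma fib_sq : f ∘ fib_fst = g ∘ fib_snd.
Proof. by apply: ooFun_ext => i x; apply: (svalP x). Qed.

Section Pairing.
Variables (T : ooCat) (a : ooFun T A) (b : ooFun T B) (ab : f ∘ a = g ∘ b).

Lemma fib_pair_subproof i (x : T i) : f i (a i x) = g i (b i x).
Proof. exact: (congr1 (fun F : ooFun T C => F i x) ab). Qed.

Definition fib_pair : ooFun T fibprod.
Proof.
exists (fun i x => exist _ (_, _) (fib_pair_subproof x)).
- by move=> e i j x; apply: fib_eq; rewrite /= !fun_bd.
- by move=> j i x y h h'; apply: fib_eq; congr pair; apply: fun_comp.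
Defined.

Lemma fib_fst_pair : fib_fst ∘ fib_pair = a.
Proof. exact: ooFun_ext. Qed.

Lemma fib_snd_pair : fib_snd ∘ fib_pair = b.
Proof. exact: ooFun_ext. Qed.

End Pairing.

Lemma fib_ext (T : ooCat) (F G : ooFun T fibprod) :
  fib_fst ∘ F = fib_fst ∘ G -> fib_snd ∘ F = fib_snd ∘ G -> F = G.
Proof.
move=> e1 e2; apply: ooFun_ext => i x; apply: fib_eq.
have := congr1 (fun H : ooFun T A => H i x) e1.
have := congr1 (fun H : ooFun T B => H i x) e2.
by rewrite /=; case: (sval (F i x)) (sval (G i x)) => [u v] [u' v'] /= -> ->.
Qed.

End FibreProduct.

Local Open Scope ring_scope.

Record adc := Adc {
  grp :> nat -> zmodType;
  diff : forall i, {additive grp i.+1 -> grp i};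
  aug : {additive grp 0 -> int};
  pos : forall i, grp i -> Prop;
  diff_diff : forall i x, diff i (diff i.+1 x) = 0;
  aug_diff : forall x, aug (diff 0 x) = 0;
  pos0 : forall i, pos (0 : grp i);
  posD : forall i (x y : grp i), pos x -> pos y -> pos (x + y)
}.
Arguments diff {a i}.
Arguments aug {a}.
Arguments pos {a i}.

Record adcHom (K L : adc) := AdcHom {
  ahom :> forall i, {additive K i -> L i};
  ahom_diff : forall i (x : K i.+1), ahom i (diff x) = diff (ahom i.+1 x);
  ahom_aug : forall x, aug (ahom 0 x) = aug x;
  ahom_pos : forall i (x : K i), pos x -> pos (ahom i x)
}.

Section Nu.
Variable K : adc.

(* Tables are indexed by all the [k : nat], with the convention
   [x_k^e = 0] for [k > i]; with this convention, the condition on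
   [d(x_(k+1)^e)] holds trivially for [k >= i]. *)
Record table (i : nat) := Table {
  tab :> bool -> forall k, K k;
  tab_pos : forall (e : bool) k, pos (tab e k);
  tab_diff : forall (e : bool) k, diff (tab e k.+1) = tab true k - tab false k;
  tab_aug : forall (e : bool), aug (tab e 0%N) = 1;
  tab_top : tab false i = tab true i;
  tab_out : forall (e : bool) k, (i < k)%N -> tab e k = 0
}.

Lemma tab_eq i (x y : table i) : (forall (e : bool) k, x e k = y e k) -> x = y.
Proof.
case: x y => x x1 x2 x3 x4 x5 [y y1 y2 y3 y4 y5] /= xy.
have E : x = y.
  by apply/funext => e; apply: functional_extensionality_dep => k; apply: xy.
by subst y; congr Table; apply: Prop_irrelevance.
Qed.

Lemma tab_high (e e' : bool) i j (x : table i) : (i <= j)%N -> x e j = x e' j.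
Proof.
rewrite leq_eqVlt => /orP[/eqP <-|ij]; last by rewrite !tab_out.
by case: e e' => [] []; rewrite // tab_top.
Qed.

Definition nu_bd (e : bool) i j (x : table i) : table j.
Proof.
exists (fun e' k => if (k < j)%N then x e' k else if k == j then x e k else 0).
- by move=> e' k; do 2?case: ifP => _; [exact: tab_pos | exact: tab_pos | exact: pos0].
- move=> e' k; have [kj|jk|kj] := ltngtP k j.
  + have [kj'|jk|kj'] := ltngtP k.+1 j; first exact: tab_diff.
      by move: jk; rewrite ltnS leqNgt kj.
    exact: tab_diff.
  + have -> : (k.+1 < j)%N = false by lia.
    have -> : (k.+1 == j)%N = false by lia.
    by rewrite raddf0 subrr.
  + by rewrite kj ltnNge leqnSn /= gtn_eqF // raddf0 subrr.
- by move=> e'; case: (ltngtP 0%N j) => // _; apply: tab_aug.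
- by rewrite ltnn eqxx.
- by move=> e' k jk; rewrite ltnNge (ltnW jk) /= gtn_eqF.
Defined.

Definition nu_glob : globSet.
Proof.
exists table nu_bd.
- move=> e i x; apply: tab_eq => e' k /=; case: ltngtP => // [ik|->].
    by rewrite tab_out.
  exact: tab_high.
- move=> e e' i j x ij; apply: tab_eq => e'' k /=.
  by case: ltngtP => // ->; apply: tab_high.
- move=> e e' i j k x ijk; apply: tab_eq => e'' m /=.
  case: ltngtP => // [mk|->].
    case: ltngtP => // [jm|mj].
      case/orP: ijk => [ij|kj]; first by rewrite tab_out // (leq_ltn_trans ij jm).
      by have := ltn_trans mk (ltn_trans kj jm); rewrite ltnn.
    case/orP: ijk => [ij|kj]; first by rewrite mj; apply: tab_high.
    by have := ltn_trans mk kj; rewrite mj ltnn.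
  case: ltngtP => // [jk|kj].
    case/orP: ijk => [ij|kj]; first by rewrite tab_out // (leq_ltn_trans ij jk).
    by have := ltn_trans jk kj; rewrite ltnn.
  case/orP: ijk => [ij|kj']; first by rewrite kj; apply: tab_high.
  by move: kj'; rewrite kj ltnn.
Defined.

Lemma nu_composableP j i (x y : nu_glob i) : composable j x y ->
  [/\ (j < i)%N, x false j = y true j &
      forall e k, (k < j)%N -> x e k = y e k].
Proof.
move=> [ji /(congr1 (fun z : table j => z : bool -> forall k, K k)) exy].
split=> // [|e k kj].
  have := congr1 (fun z : bool -> forall k, K k => z true j) exy.
  by rewrite /= ltnn eqxx.
have := congr1 (fun z : bool -> forall k, K k => z e k) exy.
by rewrite /= kj.
Qed.

(* [x *_j y], for [s_j x = t_j y], agrees with [x] and [y] below dimension [j],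
   goes from the source of [y] to the target of [x] in dimension [j], and is
   [x + y] above dimension [j]. *)
Definition nu_comp j i (x y : nu_glob i) (h : composable j x y) : nu_glob i.
Proof.
exists (fun e k => if (k < j)%N then x e k
                   else if k == j then (if e then x e k else y e k)
                   else x e k + y e k).
- move=> e k; case: ifP => _; first exact: tab_pos.
  case: ifP => _; first by case: e; apply: tab_pos.
  by apply: posD; apply: tab_pos.
- have [ji exy xy] := nu_composableP h.
  move=> e k; have [kj|jk|kj] := ltngtP k j.
  + have [kj'|jk|kj'] := ltngtP k.+1 j; first exact: tab_diff.
      by move: jk; rewrite ltnS leqNgt kj.
    by case: e; rewrite tab_diff // !xy.
  + have -> : (k.+1 < j)%N = false by lia.
    have -> : (k.+1 == j)%N = false by lia.
    by rewrite raddfD /= !tab_diff opprD addrACA.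
  + have -> : (k.+1 < j)%N = false by lia.
    have -> : (k.+1 == j)%N = false by lia.
    by subst k; rewrite raddfD /= !tab_diff exy addrA subrK.
- move=> e; case: (ltngtP 0%N j) => // _; first exact: tab_aug.
  by case: e; apply: tab_aug.
- have [ji exy xy] := nu_composableP h.
  by rewrite ltnNge (ltnW ji) /= gtn_eqF // !tab_top.
- have [ji exy xy] := nu_composableP h.
  move=> e k ik; rewrite ltnNge (ltnW (ltn_trans ji ik)) /=.
  by rewrite gtn_eqF ?(ltn_trans ji ik) // !tab_out // addr0.
Defined.

Lemma nu_compE j i (x y : nu_glob i) (h : composable j x y) e k :
  nu_comp h e k = if (k < j)%N then x e k
                  else if k == j then (if e then x e k else y e k)
                  else x e k + y e k.
Proof. by []. Qed.

Lemma nu_bdE e' i j (x : nu_glob i) e k :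
  (bd e' j x : table j) e k =
    if (k < j)%N then x e k else if k == j then x e' k else 0.
Proof. by []. Qed.

Definition nu : ooCat.
Proof.
exists nu_glob nu_comp.
- move=> j i x y h; have [ji exy xy] := nu_composableP h.
  apply: tab_eq => e k; rewrite !nu_bdE !nu_compE.
  by case: ltngtP => // kj; rewrite xy.
- move=> j i x y h; have [ji exy xy] := nu_composableP h.
  apply: tab_eq => e k; rewrite !nu_bdE !nu_compE.
  by case: ltngtP.
- move=> e j k i x y h h'; have [ji exy xy] := nu_composableP h.
  have [jk _ _] := nu_composableP h'.
  apply: tab_eq => e' m; rewrite !nu_compE !nu_bdE !nu_compE.
  case: (ltngtP m j) => [mj|jm|mj].
  + by rewrite (ltn_trans mj jk).
  + by do 2?case: ifP => //; rewrite addr0.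
  + by subst m; rewrite jk.
- move=> e j i x h; have [ji exy xy] := nu_composableP h.
  apply: tab_eq => e' m; rewrite !nu_compE !nu_bdE.
  case: (ltngtP m j) => [//|jm|mj].
  + by do 2?case: ifP => //; rewrite addr0.
  + by subst m; rewrite ji; case: e'.
- move=> e j i x h; have [ji exy xy] := nu_composableP h.
  apply: tab_eq => e' m; rewrite !nu_compE !nu_bdE.
  case: (ltngtP m j) => [mj|jm|mj].
  + by rewrite (ltn_trans mj ji).
  + by do 2?case: ifP => //; rewrite add0r.
  + by subst m; rewrite ji; case: e'.
- move=> j i x y z hxy hyz h1 h2; apply: tab_eq => e k; rewrite !nu_compE.
  by case: ltngtP => // _; [rewrite addrA | case: e].
- move=> j k i x y z w jk hxy hzw h1 hxz hyw h2.
  have [ki exy xy] := nu_composableP hxy.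
  have [_ ezw zw] := nu_composableP hzw.
  apply: tab_eq => e m; rewrite !nu_compE.
  case: (ltngtP m j) => [mj|jm|mj].
  + by rewrite (ltn_trans mj jk).
  + by case: (ltngtP m k) => // _; [rewrite addrACA | case: e].
  + by subst m; rewrite jk; case: e; rewrite // zw.
Defined.

End Nu.

Section NuMap.
Variables (K L : adc) (f : adcHom K L).

Definition nu_map_tab i (x : table K i) : table L i.
Proof.
exists (fun e k => f k (x e k)).
- by move=> e k; apply/ahom_pos/tab_pos.
- by move=> e k; rewrite -ahom_diff tab_diff raddfB.
- by move=> e; rewrite ahom_aug tab_aug.
- by rewrite tab_top.
- by move=> e k ik; rewrite tab_out // raddf0.
Defined.

Definition nu_map : ooFun (nu K) (nu L).
Proof.
exists nu_map_tab.
- move=> e i j x; apply: tab_eq => e' k /=.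
  by do 2?case: ifP => _ //; rewrite raddf0.
- move=> j i x y h h'; apply: tab_eq => e k /=.
  by do 2?case: ifP => _ //; [case: e | rewrite raddfD].
Defined.

End NuMap.

Inductive gen_submonoid (G : zmodType) (S : G -> Prop) : G -> Prop :=
| gen_mem x : S x -> gen_submonoid S x
| gen_zero : gen_submonoid S 0
| gen_add x y : gen_submonoid S x -> gen_submonoid S y ->
    gen_submonoid S (x + y).

Section ZBasis.
Variables (G : zmodType) (B : G -> Prop).

Definition is_coords (x : G) (f : {fsfun G -> int with 0}) : Prop :=
  (forall b, f b <> 0 -> B b) /\ x = \sum_(b <- finsupp f) b *~ f b.

Definition is_zbasis : Prop := forall x, exists! f, is_coords x f.

Definition coords (x : G) : {fsfun G -> int with 0} :=
  if pselect (exists f, is_coords x f) is left h then sval (cid h)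
  else [fsfun].

(* [x_-] for [e = false], [x_+] for [e = true]. *)
Definition part (e : bool) (x : G) : G :=
  \sum_(b <- finsupp (coords x))
    b *~ Num.max (if e then coords x b else - coords x b) 0.

Definition in_supp (x b : G) : Prop := coords x b <> 0.

End ZBasis.

Section Steiner.
Variables (K : adc) (B : forall i, K i -> Prop).

Definition is_basis : Prop :=
  (forall i, is_zbasis (@B i)) /\
  (forall i (x : K i), pos x <-> gen_submonoid (@B i) x).

(* [bracket0 e x] is the entry [<x>_0^e] of the table [<x>]. *)
Fixpoint bracket0 (e : bool) (i : nat) : K i -> K 0%N :=
  match i with
  | 0%N => fun x => x
  | i'.+1 => fun x => bracket0 e (part (@B i') e (diff x))
  end.

Definition unital : Prop :=
  forall e i (b : K i), B b -> aug (bracket0 e b) = 1.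

Inductive basis_step : {i : nat & K i} -> {i : nat & K i} -> Prop :=
| step_src i (x : K i.+1) (y : K i) : B x ->
    in_supp (@B i) (part (@B i) false (diff x)) y ->
    basis_step (existT _ i y) (existT _ i.+1 x)
| step_tgt i (x : K i.+1) (z : K i) : B x ->
    in_supp (@B i) (part (@B i) true (diff x)) z ->
    basis_step (existT _ i.+1 x) (existT _ i z).

Definition strongly_loop_free : Prop :=
  forall p q, clos_refl_trans _ basis_step p q ->
    clos_refl_trans _ basis_step q p -> p = q.

End Steiner.

Definition strong_Steiner (K : adc) : Prop :=
  exists B : forall i, K i -> Prop,
    [/\ is_basis B, unital B & strongly_loop_free B].

Section TensorGroup.
Variables (K L : adc) (n : nat).

(* The group [(K ⊗ L)_n], presented by the generators [x ⊗ y], for [x] in [K_i]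
   and [y] in [L_j] with [i + j = n], and by the relations of bilinearity. *)
Inductive word : Type :=
| Wzero
| Wadd of word & word
| Wopp of word
| Wtens i j of (i + j)%N = n & K i & L j.

Inductive weq : word -> word -> Prop :=
| weq_refl a : weq a a
| weq_sym a b : weq a b -> weq b a
| weq_trans a b c : weq a b -> weq b c -> weq a c
| weq_add a a' b b' : weq a a' -> weq b b' -> weq (Wadd a b) (Wadd a' b')
| weq_opp a a' : weq a a' -> weq (Wopp a) (Wopp a')
| weq_addA a b c : weq (Wadd a (Wadd b c)) (Wadd (Wadd a b) c)
| weq_addC a b : weq (Wadd a b) (Wadd b a)
| weq_add0 a : weq (Wadd Wzero a) a
| weq_addN a : weq (Wadd (Wopp a) a) Wzero
| weq_tensDl i j (h : (i + j)%N = n) (x x' : K i) (y : L j) :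
    weq (Wtens h (x + x') y) (Wadd (Wtens h x y) (Wtens h x' y))
| weq_tensDr i j (h : (i + j)%N = n) (x : K i) (y y' : L j) :
    weq (Wtens h x (y + y')) (Wadd (Wtens h x y) (Wtens h x y')).

HB.instance Definition _ := gen_eqMixin word.
HB.instance Definition _ := gen_choiceMixin word.

Definition weqb : rel word := fun a b => `[< weq a b >].

Lemma weqb_equiv : equiv_class_of weqb.
Proof.
split=> [a|a b|b a c]; rewrite /weqb.
- exact/asboolP/weq_refl.
- by apply/asboolP/asboolP => /weq_sym.
- by move=> /asboolP ab /asboolP bc; apply/asboolP/(weq_trans ab bc).
Qed.

Canonical weqb_equivrel := EquivRelPack weqb_equiv.
Canonical weqb_encmodrel := defaultEncModRel weqb.

Local Open Scope quotient_scope.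

Definition tgrp := {eq_quot weqb}.
HB.instance Definition _ := Choice.on tgrp.

Definition tpi (a : word) : tgrp := \pi_tgrp a.

Lemma tpiE a b : (tpi a = tpi b) <-> weq a b.
Proof. by split=> [/eqmodP/asboolP | ab]; last exact/eqmodP/asboolP. Qed.

Lemma weq_repr a : weq (repr (tpi a)) a.
Proof. by apply/tpiE; rewrite /tpi reprK. Qed.

Lemma tpi_repr (t : tgrp) : tpi (repr t) = t.
Proof. exact: reprK. Qed.

Definition tadd (s t : tgrp) : tgrp := tpi (Wadd (repr s) (repr t)).
Definition topp (t : tgrp) : tgrp := tpi (Wopp (repr t)).

Lemma tpiD a b : tpi (Wadd a b) = tadd (tpi a) (tpi b).
Proof. by apply/tpiE/weq_add; apply/weq_sym/weq_repr. Qed.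

Lemma tpiN a : tpi (Wopp a) = topp (tpi a).
Proof. by apply/tpiE/weq_opp; apply/weq_sym/weq_repr. Qed.

Lemma taddA : associative tadd.
Proof.
move=> s t u; rewrite -(tpi_repr s) -(tpi_repr t) -(tpi_repr u) -!tpiD.
exact/tpiE/weq_addA.
Qed.

Lemma taddC : commutative tadd.
Proof.
move=> s t; rewrite -(tpi_repr s) -(tpi_repr t) -!tpiD.
exact/tpiE/weq_addC.
Qed.

Lemma tadd0 : left_id (tpi Wzero) tadd.
Proof. by move=> s; rewrite -(tpi_repr s) -tpiD; apply/tpiE/weq_add0. Qed.

Lemma taddN : left_inverse (tpi Wzero) topp tadd.
Proof. by move=> s; rewrite -(tpi_repr s) -tpiN -tpiD; apply/tpiE/weq_addN. Qed.

HB.instance Definition _ := GRing.isZmodule.Build tgrp taddA taddC tadd0 taddN.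

Definition tens i j (h : (i + j)%N = n) (x : K i) (y : L j) : tgrp :=
  tpi (Wtens h x y).

Lemma tensDl i j (h : (i + j)%N = n) x x' (y : L j) :
  tens h (x + x') y = tens h x y + tens h x' y.
Proof. by rewrite /tens -[RHS]tpiD; apply/tpiE/weq_tensDl. Qed.

Lemma tensDr i j (h : (i + j)%N = n) (x : K i) y y' :
  tens h x (y + y') = tens h x y + tens h x y'.
Proof. by rewrite /tens -[RHS]tpiD; apply/tpiE/weq_tensDr. Qed.

Lemma tens_irr i j (h h' : (i + j)%N = n) (x : K i) (y : L j) :
  tens h x y = tens h' x y.
Proof. by rewrite (eq_irrelevance h h'). Qed.

Lemma tens0l i j (h : (i + j)%N = n) (y : L j) : tens h 0 y = 0.
Proof. by apply: (addrI (tens h 0 y)); rewrite -tensDl !addr0. Qed.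

Lemma tens0r i j (h : (i + j)%N = n) (x : K i) : tens h x 0 = 0.
Proof. by apply: (addrI (tens h x 0)); rewrite -tensDr !addr0. Qed.

Lemma tensMzr i j (h : (i + j)%N = n) (x : K i) (y : L j) (m : int) :
  tens h x (y *~ m) = tens h x y *~ m.
Proof.
have D (p : nat) : tens h x (y *+ p) = tens h x y *+ p.
  by elim: p => [|p IHp]; rewrite ?tens0r // !mulrS tensDr IHp.
case: m => p; first exact: D.
by apply: (addrI (tens h x (y *+ p.+1))); rewrite -tensDr subrr tens0r D subrr.
Qed.

Lemma tens_ind (P : tgrp -> Prop) :
  P 0 -> (forall s t, P s -> P t -> P (s + t)) ->
  (forall t, P t -> P (- t)) ->
  (forall i j (h : (i + j)%N = n) x y, P (tens h x y)) ->
  forall t, P t.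
Proof.
move=> P0 PD PN Pt t; rewrite -(tpi_repr t).
elim: (repr t) => [//|a Pa b Pb|a Pa|//]; last by rewrite tpiN; apply: PN.
by rewrite tpiD; apply: PD.
Qed.

Section Lift.
Variables (G : zmodType) (f : forall i j, (i + j)%N = n -> K i -> L j -> G).
Hypothesis fDl : forall i j (h : (i + j)%N = n) (x x' : K i) (y : L j),
  f h (x + x') y = f h x y + f h x' y.
Hypothesis fDr : forall i j (h : (i + j)%N = n) (x : K i) (y y' : L j),
  f h x (y + y') = f h x y + f h x y'.

Fixpoint wlift (a : word) : G :=
  match a with
  | Wzero => 0
  | Wadd a b => wlift a + wlift b
  | Wopp a => - wlift a
  | Wtens i j h x y => f h x y
  end.

Lemma wlift_weq a b : weq a b -> wlift a = wlift b.
Proof.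
elim=> //=; intros; rewrite ?fDl ?fDr ?addrA ?add0r ?addNr //; try congruence.
by rewrite addrC.
Qed.

Definition tlift_fun (t : tgrp) : G := wlift (repr t).

Lemma tlift_is_additive : {morph tlift_fun : s t / s - t}.
Proof.
move=> s t; rewrite -(tpi_repr s) -(tpi_repr t) -[- tpi _]tpiN -[_ + _]tpiD.
by rewrite /tlift_fun !(wlift_weq (weq_repr _)).
Qed.

HB.instance Definition _ :=
  GRing.isZmodMorphism.Build tgrp G tlift_fun tlift_is_additive.

Definition tlift : {additive tgrp -> G} := tlift_fun.

Lemma tliftE i j (h : (i + j)%N = n) x y : tlift (tens h x y) = f h x y.
Proof. exact: (wlift_weq (weq_repr _)). Qed.

End Lift.

End TensorGroup.

Section TensorComplex.
Variables K L : adc.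

Lemma addSn_inj i j n : (i.+1 + j)%N = n.+1 -> (i + j)%N = n.
Proof. by case. Qed.

Lemma addnS_inj i j n : (i + j.+1)%N = n.+1 -> (i + j)%N = n.
Proof. by rewrite addnS; case. Qed.

(* [dx ⊗ y], to be read as [0] when [x] is of degree [0]. *)
Definition dtensl n i : forall j, (i + j)%N = n.+1 -> K i -> L j -> tgrp K L n :=
  match i with
  | 0%N => fun j _ _ _ => 0
  | i'.+1 => fun j h x y => tens (addSn_inj h) (diff x) y
  end.

(* [x ⊗ dy], to be read as [0] when [y] is of degree [0]. *)
Definition dtensr n i j : (i + j)%N = n.+1 -> K i -> L j -> tgrp K L n :=
  match j with
  | 0%N => fun _ _ _ => 0
  | j'.+1 => fun h x y => tens (addnS_inj h) x (diff y)
  end.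

Definition dtens n i j (h : (i + j)%N = n.+1) (x : K i) (y : L j) :
  tgrp K L n := dtensl h x y + dtensr h x y *~ (-1) ^+ i.

Lemma dtensDl n i j (h : (i + j)%N = n.+1) (x x' : K i) (y : L j) :
  dtens h (x + x') y = dtens h x y + dtens h x' y.
Proof.
rewrite /dtens addrACA -mulrzDl; congr (_ + _ *~ _).
  by case: i h x x' => [|i] h x x' /=; rewrite ?addr0 // raddfD tensDl.
by case: j h y => [|j] h y /=; rewrite ?addr0 // tensDl.
Qed.

Lemma dtensDr n i j (h : (i + j)%N = n.+1) (x : K i) (y y' : L j) :
  dtens h x (y + y') = dtens h x y + dtens h x y'.
Proof.
rewrite /dtens addrACA -mulrzDl; congr (_ + _ *~ _).
  by case: i h x => [|i] h x /=; rewrite ?addr0 // tensDr.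
by case: j h y y' => [|j] h y y' /=; rewrite ?addr0 // raddfD tensDr.
Qed.

Definition tdiff n : {additive tgrp K L n.+1 -> tgrp K L n} :=
  tlift (@dtensDl n) (@dtensDr n).

Lemma tdiffE n i j (h : (i + j)%N = n.+1) (x : K i) (y : L j) :
  tdiff n (tens h x y) = dtens h x y.
Proof. exact: tliftE. Qed.

Lemma tdiff_tdiff n (t : tgrp K L n.+2) : tdiff n (tdiff n.+1 t) = 0.
Proof.
elim/tens_ind: t => [|s t Ps Pt|t Pt|i j h x y].
- by rewrite !raddf0.
- by rewrite !raddfD /= Ps Pt addr0.
- by rewrite !raddfN /= Pt oppr0.
move: (tdiffE) => DE; move: tdiff DE => D DE.
rewrite DE /dtens raddfD /= raddfMz /=.
case: i h x => [|i] h x; case: j h y => [|j] h y /=;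
  rewrite ?raddf0 ?mul0rz ?add0r ?addr0 //.
- by rewrite DE /dtens /=; case: j h y => [|j] h y //=;
    rewrite ?diff_diff ?tens0r ?mul0rz ?addr0 ?mul0rz.
- by rewrite DE /dtens /=; case: i h x => [|i] h x //=;
    rewrite ?diff_diff ?tens0l ?mul0rz ?addr0.
rewrite !DE /dtens /=.
have -> : dtensl (addSn_inj h) (diff x) y = 0.
  by case: i h x => [|i] h x //=; rewrite diff_diff tens0l.
have -> : dtensr (addnS_inj h) x (diff y) = 0.
  by case: j h y => [|j] h y //=; rewrite diff_diff tens0r.
rewrite mul0rz add0r addr0 exprS mulN1r mulrNz.
by rewrite (tens_irr (addnS_inj _) (addSn_inj (addnS_inj h))) subrr.
Qed.

Definition atens i j : (i + j)%N = 0%N -> K i -> L j -> int :=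
  match i, j with
  | 0%N, 0%N => fun _ x y => aug x * aug y
  | _, _ => fun _ _ _ => 0
  end.

Lemma atensDl i j (h : (i + j)%N = 0%N) (x x' : K i) (y : L j) :
  atens h (x + x') y = atens h x y + atens h x' y.
Proof. by case: i j h x x' y => [|i] [|j] h x x' y //=; rewrite raddfD mulrDl. Qed.

Lemma atensDr i j (h : (i + j)%N = 0%N) (x : K i) (y y' : L j) :
  atens h x (y + y') = atens h x y + atens h x y'.
Proof. by case: i j h x y y' => [|i] [|j] h x y y' //=; rewrite raddfD mulrDr. Qed.

Definition taug : {additive tgrp K L 0 -> int} := tlift atensDl atensDr.

Lemma taugE i j (h : (i + j)%N = 0%N) (x : K i) (y : L j) :
  taug (tens h x y) = atens h x y.
Proof. exact: tliftE. Qed.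

Lemma taug_tdiff (t : tgrp K L 1) : taug (tdiff 0 t) = 0.
Proof.
elim/tens_ind: t => [|s t Ps Pt|t Pt|i j h x y].
- by rewrite !raddf0.
- by rewrite !raddfD /= Ps Pt addr0.
- by rewrite !raddfN /= Pt oppr0.
rewrite tdiffE.
move: (taugE) => AE; move: taug AE => A AE.
rewrite /dtens raddfD /= raddfMz /=.
case: i h x => [|[|i]] h x; case: j h y => [|[|j]] h y //=;
  by rewrite ?raddf0 ?mul0rz ?AE /= ?aug_diff ?mul0r ?mulr0 ?mul0rz ?addr0.
Qed.

Inductive pure_pos n : tgrp K L n -> Prop :=
| PurePos i j (h : (i + j)%N = n) (x : K i) (y : L j) :
    pos x -> pos y -> pure_pos (tens h x y).

Definition adc_tens : adc :=
  @Adc (fun n => tgrp K L n) tdiff taug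
    (fun n => gen_submonoid (@pure_pos n))
    tdiff_tdiff taug_tdiff
    (fun n => gen_zero _) (fun n => @gen_add _ (@pure_pos n)).

End TensorComplex.

Definition unit_grp (i : nat) : zmodType :=
  if i is 0%N then int : zmodType else 'rV[int]_0.

Definition unit_pos i : unit_grp i -> Prop :=
  if i is 0%N then fun x : int => 0 <= x else fun=> True.

Definition adc_unit : adc.
Proof.
refine (@Adc unit_grp (fun i => \0 : {additive _ -> _}) (idfun : {additive int -> int}) unit_pos _ _ _ _) => //.
- by case.
- by case=> //= x y; apply: addr_ge0.
Defined.

Section AdcLift.
Variables (K L M : adc).
Variable f : forall n i j, (i + j)%N = n -> K i -> L j -> M n.
Hypothesis fDl : forall n i j (h : (i + j)%N = n) (x x' : K i) (y : L j),
  f h (x + x') y = f h x y + f h x' y.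
Hypothesis fDr : forall n i j (h : (i + j)%N = n) (x : K i) (y y' : L j),
  f h x (y + y') = f h x y + f h x y'.
Hypothesis f_diff : forall n i j (h : (i + j)%N = n.+1) (x : K i) (y : L j),
  diff (f h x y) = tlift (@fDl n) (@fDr n) (dtens h x y).
Hypothesis f_aug : forall i j (h : (i + j)%N = 0%N) (x : K i) (y : L j),
  aug (f h x y) = atens h x y.
Hypothesis f_pos : forall n i j (h : (i + j)%N = n) (x : K i) (y : L j),
  pos x -> pos y -> pos (f h x y).

Definition adc_lift : adcHom (adc_tens K L) M.
Proof.
exists (fun n => tlift (@fDl n) (@fDr n)).
- move=> n; elim/tens_ind => [|s t Ps Pt|t Pt|i j h x y].
  + by rewrite !raddf0.
  + rewrite [diff _]raddfD [LHS]raddfD Ps Pt [in RHS]raddfD.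
    by rewrite raddfD.
  + by rewrite [diff _]raddfN [LHS]raddfN Pt [in RHS]raddfN raddfN.
  + by rewrite [diff _]tdiffE [in RHS]tliftE f_diff.
- elim/tens_ind => [|s t Ps Pt|t Pt|i j h x y].
  + by rewrite !raddf0.
  + by rewrite [in LHS]raddfD [LHS]raddfD Ps Pt [RHS]raddfD.
  + by rewrite [in LHS]raddfN [LHS]raddfN Pt [RHS]raddfN.
  + by rewrite [in LHS]tliftE f_aug [RHS]taugE.
- move=> n x; elim=> [_ [i j h a b pa pb]||s t _ Ps _ Pt].
  + by rewrite tliftE; apply: f_pos.
  + by rewrite raddf0; apply: pos0.
  + by rewrite raddfD; apply: posD.
Defined.

Lemma adc_liftE n i j (h : (i + j)%N = n) x y :
  adc_lift n (tens h x y) = f h x y.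
Proof. exact: tliftE. Qed.

End AdcLift.

Section AdcTensMap.
Variables (K K' L L' : adc) (f : adcHom K K') (g : adcHom L L').

Definition tmap n i j (h : (i + j)%N = n) (x : K i) (y : L j) :
  adc_tens K' L' n := tens h (f i x) (g j y).

Definition adc_tens_map : adcHom (adc_tens K L) (adc_tens K' L').
Proof.
apply: (@adc_lift K L (adc_tens K' L') tmap).
- by move=> *; rewrite /tmap raddfD tensDl.
- by move=> *; rewrite /tmap raddfD tensDr.
- move=> fDl fDr n i j h x y.
  rewrite [LHS]tdiffE /dtens [RHS]raddfD [in RHS]raddfMz.
  congr (_ + _ *~ _).
    case: i h x => [|i] h x; first by rewrite [RHS]raddf0.
    by rewrite [RHS]tliftE /tmap ahom_diff.
  case: j h y => [|j] h y; first by rewrite [RHS]raddf0.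
  by rewrite [RHS]tliftE /tmap ahom_diff.
- move=> i j h x y; rewrite [LHS]taugE.
  by case: i j h x y => [|i] [|j] h x y //=; rewrite !ahom_aug.
- by move=> n i j h x y px py; apply: gen_mem; apply: PurePos; apply: ahom_pos.
Defined.

Lemma adc_tens_mapE n i j (h : (i + j)%N = n) x y :
  adc_tens_map n (tens h x y) = tens h (f i x) (g j y).
Proof. exact: tliftE. Qed.

End AdcTensMap.

Section AdcUnitors.
Variable K : adc.

Definition lun n i j : (i + j)%N = n -> unit_grp i -> K j -> K n :=
  match i with
  | 0%N => fun h (m : int) y => ecast k (K k) h (y *~ m)
  | _ => fun _ _ _ => 0
  end.

(* [m ⊗ y] is sent to [m y]. *)
Definition adc_lunit : adcHom (adc_tens adc_unit K) K.
Proof.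
apply: (@adc_lift adc_unit K K lun).
- move=> n [|i] j h x x' y /=; last by rewrite addr0.
  by case: n / h; rewrite /= mulrzDr.
- move=> n [|i] j h x y y' /=; last by rewrite addr0.
  by case: n / h; rewrite /= mulrzDl.
- move=> fDl fDr n [|i] j h x y; rewrite /dtens [RHS]raddfD [in RHS]raddfMz.
    rewrite [X in _ = X + _]raddf0 add0r expr0 mulr1z.
    case: j h y => // j h y; rewrite [RHS]tliftE /=.
    have h' : j = n by case: h.
    by subst n; rewrite !(eq_axiomK (_ : _ = _)) /= raddfMz.
  rewrite [LHS]raddf0 [dtensl _ _ _]tens0l [X in _ = X + _]raddf0 add0r.
  by case: j h y => [|j] h y; rewrite [X in X *~ _](_ : _ = 0) ?mul0rz //;
    rewrite ?raddf0 ?[LHS]tliftE.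
- move=> [|i] [|j] h x y //=; rewrite (eq_axiomK h) /= raddfMz /=.
  by rewrite -mulrzl intz.
- move=> n [|i] j h x y /=; last by move=> *; apply: pos0.
  case: n / h => /=; case: x => // m _ py.
  by elim: m => [|m IHm]; [exact: pos0 | rewrite -pmulrn mulrS; apply: posD].
Defined.

Lemma adc_lunitE n (h : (0 + n)%N = n) (m : int) (y : K n) :
  adc_lunit n (@tens adc_unit K n 0 n h m y) = y *~ m.
Proof. by rewrite [LHS]tliftE /= (eq_axiomK h). Qed.

Definition run n i j : (i + j)%N = n -> K i -> unit_grp j -> K n :=
  match j with
  | 0%N => fun h x (m : int) =>
      ecast k (K k) (etrans (esym (addn0 i)) h) (x *~ m)
  | _ => fun _ _ _ => 0
  end.

(* [x ⊗ m] is sent to [m x]. *)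
Definition adc_runit : adcHom (adc_tens K adc_unit) K.
Proof.
apply: (@adc_lift K adc_unit K run).
- move=> n i [|j] h x x' y /=; last by rewrite addr0.
  by move: (etrans _ h) => h1; case: n / h1 h => h; rewrite /= mulrzDl.
- move=> n i [|j] h x y y' /=; last by rewrite addr0.
  by move: (etrans _ h) => h1; case: n / h1 h => h; rewrite /= mulrzDr.
- move=> fDl fDr n i [|j] h x y; rewrite /dtens [RHS]raddfD [in RHS]raddfMz.
    rewrite [X in _ = _ + X *~ _]raddf0 mul0rz addr0.
    case: i h x => [//|i] h x; rewrite [RHS]tliftE /=.
    have h' : i = n by case: h; rewrite addn0.
    by subst n; rewrite !(eq_axiomK (etrans _ _)) /= raddfMz.
  rewrite [LHS]raddf0 [dtensr _ _ _]tens0r [X in _ = _ + X *~ _]raddf0.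
  rewrite mul0rz addr0.
  by case: i h x => [|i] h x; rewrite ?[RHS]raddf0 ?[RHS]tliftE.
- move=> [|i] [|j] h x y //=; rewrite (eq_axiomK (etrans _ _)) /= raddfMz /=.
  by rewrite -mulrzr intz.
- move=> n i [|j] h x y /=; last by move=> *; apply: pos0.
  move: (etrans _ h) => h1; case: n / h1 h => /= h px; case: y => // m _.
  by elim: m => [|m IHm]; [exact: pos0 | rewrite -pmulrn mulrS; apply: posD].
Defined.

Lemma adc_runitE n (h : (n + 0)%N = n) (x : K n) (m : int) :
  adc_runit n (@tens K adc_unit n n 0 h x m) = x *~ m.
Proof. by rewrite [LHS]tliftE /= (eq_axiomK (etrans _ _)). Qed.

End AdcUnitors.

Section AdcAssoc.
Variables K L M : adc.

Lemma asc_eq i j k p n : (p + k)%N = n -> (i + j)%N = p -> (i + (j + k))%N = n.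
Proof. by move=> <- <-; rewrite addnA. Qed.

Definition asc_gen n p k (h : (p + k)%N = n) (z : M k) i j
    (h' : (i + j)%N = p) (x : K i) (y : L j) : adc_tens K (adc_tens L M) n :=
  @tens K (adc_tens L M) n i _ (asc_eq h h') x (tens (erefl (j + k)%N) y z).

Lemma asc_genDl n p k (h : (p + k)%N = n) (z : M k) i j (h' : (i + j)%N = p)
    (x x' : K i) (y : L j) :
  asc_gen h z h' (x + x') y = asc_gen h z h' x y + asc_gen h z h' x' y.
Proof. by rewrite /asc_gen tensDl. Qed.

Lemma asc_genDr n p k (h : (p + k)%N = n) (z : M k) i j (h' : (i + j)%N = p)
    (x : K i) (y y' : L j) :
  asc_gen h z h' x (y + y') = asc_gen h z h' x y + asc_gen h z h' x y'.
Proof. by rewrite /asc_gen tensDl tensDr. Qed.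

Definition asc n p k (h : (p + k)%N = n) (t : adc_tens K L p) (z : M k) :
    adc_tens K (adc_tens L M) n :=
  tlift (@asc_genDl n p k h z) (@asc_genDr n p k h z) t.

Lemma ascDl n p k (h : (p + k)%N = n) t t' (z : M k) :
  asc h (t + t') z = asc h t z + asc h t' z.
Proof. exact: raddfD. Qed.

Lemma asc0 n p k (h : (p + k)%N = n) (z : M k) : asc h 0 z = 0.
Proof. exact: raddf0. Qed.

Lemma ascN n p k (h : (p + k)%N = n) t (z : M k) :
  asc h (- t) z = - asc h t z.
Proof. exact: raddfN. Qed.

Lemma ascE n p k (h : (p + k)%N = n) i j (h' : (i + j)%N = p) x y (z : M k) :
  asc h (tens h' x y) z = asc_gen h z h' x y.
Proof. exact: tliftE. Qed.

Lemma ascDr n p k (h : (p + k)%N = n) t (z z' : M k) :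
  asc h t (z + z') = asc h t z + asc h t z'.
Proof.
elim/tens_ind: t => [|s t Ps Pt|t Pt|i j h' x y].
- by rewrite !asc0 addr0.
- by rewrite !ascDl Ps Pt addrACA.
- by rewrite !ascN Pt opprD.
- by rewrite !ascE /asc_gen !tensDr.
Qed.

Lemma ascMz n p k (h : (p + k)%N = n) t (z : M k) (m : int) :
  asc h (t *~ m) z = asc h t z *~ m.
Proof. exact: raddfMz. Qed.

Lemma asc_genE n p k (h : (p + k)%N = n) (z : M k) i j (h' : (i + j)%N = p)
    (x : K i) (y : L j) m (g : (j + k)%N = m) (h'' : (i + m)%N = n) :
  @tens K (adc_tens L M) n i m h'' x (tens g y z) = asc_gen h z h' x y.
Proof. by case: m / g h'' => h''; apply: tens_irr. Qed.

(* [(x ⊗ y) ⊗ z] is sent to [x ⊗ (y ⊗ z)]. *)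
Definition adc_assoc :
  adcHom (adc_tens (adc_tens K L) M) (adc_tens K (adc_tens L M)).
Proof.
apply: (@adc_lift (adc_tens K L) M (adc_tens K (adc_tens L M)) asc).
- exact: ascDl.
- exact: ascDr.
- move=> fDl fDr n p k h t z.
  have dl0 : tlift (@fDl n) (@fDr n) (@dtens (adc_tens K L) M n p k h 0 z) = 0.
    rewrite (_ : dtens _ _ _ = 0) ?raddf0 //.
    by apply: (addrI (@dtens (adc_tens K L) M n p k h 0 z)); rewrite -dtensDl !addr0.
  have dlD s u : tlift (@fDl n) (@fDr n) (@dtens (adc_tens K L) M n p k h (s + u) z) =
      tlift (@fDl n) (@fDr n) (@dtens (adc_tens K L) M n p k h s z) +
      tlift (@fDl n) (@fDr n) (@dtens (adc_tens K L) M n p k h u z).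
    by rewrite dtensDl raddfD.
  elim/tens_ind: t => [|s t Ps Pt|t Pt|i j h' x y].
  + by rewrite asc0 dl0 raddf0.
  + by rewrite ascDl dlD raddfD Ps Pt.
  + apply: (addrI (diff (asc h t z))); rewrite -raddfD -ascDl subrr asc0 raddf0.
    by rewrite Pt -dlD subrr dl0.
  rewrite ascE [LHS]tdiffE /dtens [RHS]raddfD [in RHS]raddfMz.
  have t0 : tlift (@fDl n) (@fDr n) 0 = 0 by exact: raddf0.
  have tE := @tliftE (adc_tens K L) M n _ _ (@fDl n) (@fDr n).
  have dE K' L' m a b (g : (a + b)%N = m.+1) u v :
    @diff (adc_tens K' L') m (tens g u v) = dtens g u v := tdiffE g u v.
  case: p / h' h {dl0 dlD} => h; rewrite exprD.
  case: i j k h x y z => [|i] [|j] [|k] h x y z; lazy beta iota zeta delta [dtensl dtensr addn Nat.add].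
  1-8: lazy beta iota zeta delta [dtensl dtensr addn Nat.add].
  1-8: rewrite ?t0 ?tE ?ascE ?dE /dtens.
  1-8: lazy beta iota zeta delta [dtensl dtensr addn Nat.add].
  1-8: rewrite ?(ascDl, ascMz, asc0, ascE, tensDr, tensMzr, tens0r, mul0rz, add0r, addr0) //.
  1-7: rewrite ?mulrzDl ?mulrzA ?addrA.
  1-7: repeat congr (_ + _); rewrite -?mulrzA 1?[_ * _ in RHS]mulrC;
    try congr (_ *~ _); exact: asc_genE.
- move=> p k h t z; elim/tens_ind: t => [|s t Ps Pt|t Pt|i j h' x y].
  + rewrite asc0 [LHS]raddf0; case: p k h z => [|p] [|k] h z //.
    by rewrite /atens [aug _]raddf0 mul0r.
  + by rewrite ascDl atensDl [LHS]raddfD Ps Pt.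
  + rewrite ascN [LHS]raddfN Pt; case: p k h z t {Pt} => [|p] [|k] h z t //.
    by rewrite /atens [X in _ = X * _]raddfN mulNr.
  rewrite ascE [LHS]taugE.
  case: p / h' h => h; case: i j k h x y z => [|i] [|j] [|k] h x y z //=.
  by rewrite !taugE /= mulrA.
- move=> n p k h t z; elim=> [_ [i j h' x y px py]||s u _ Ps _ Pt] pz.
  + rewrite ascE; apply: gen_mem; apply: PurePos => //.
    by apply: gen_mem; apply: PurePos.
  + by rewrite asc0; apply: gen_zero.
  + by rewrite ascDl; apply: gen_add; [apply: Ps | apply: Pt].
Defined.

Lemma adc_assocE n p i j k (h : (p + k)%N = n) (h' : (i + j)%N = p)
    (h'' : (i + (j + k))%N = n) (x : K i) (y : L j) (z : M k) :
  adc_assoc n (@tens (adc_tens K L) M n p k h (tens h' x y) z) =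
  @tens K (adc_tens L M) n i (j + k) h'' x (tens (erefl (j + k)%N) y z).
Proof. by rewrite [LHS]tliftE ascE; symmetry; apply: asc_genE. Qed.

End AdcAssoc.

Record monoidal := Monoidal {
  gt : ooCat -> ooCat -> ooCat;
  gtm : forall A A' B B', ooFun A A' -> ooFun B B' -> ooFun (gt A B) (gt A' B');
  gtm_id : forall A B, gtm (fid A) (fid B) = fid (gt A B);
  gtm_comp : forall A A' A'' B B' B''
      (f : ooFun A A') (f' : ooFun A' A'') (g : ooFun B B') (g' : ooFun B' B''),
    gtm (f' ∘ f) (g' ∘ g) = gtm f' g' ∘ gtm f g;
  gassoc : forall A B C, ooFun (gt (gt A B) C) (gt A (gt B C));
  gassoc_inv : forall A B C, ooFun (gt A (gt B C)) (gt (gt A B) C);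
  gassocK : forall A B C, fcancel (gassoc A B C) (gassoc_inv A B C);
  gassoc_nat : forall A A' B B' C C'
      (f : ooFun A A') (g : ooFun B B') (h : ooFun C C'),
    gassoc A' B' C' ∘ gtm (gtm f g) h = gtm f (gtm g h) ∘ gassoc A B C;
  glun : forall A, ooFun (gt (disk 0) A) A;
  glun_inv : forall A, ooFun A (gt (disk 0) A);
  glunK : forall A, fcancel (glun A) (glun_inv A);
  glun_nat : forall A A' (f : ooFun A A'),
    glun A' ∘ gtm (fid (disk 0)) f = f ∘ glun A;
  grun : forall A, ooFun (gt A (disk 0)) A;
  grun_inv : forall A, ooFun A (gt A (disk 0));
  grunK : forall A, fcancel (grun A) (grun_inv A);
  grun_nat : forall A A' (f : ooFun A A'),
    grun A' ∘ gtm f (fid (disk 0)) = f ∘ grun A;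
  gpentagon : forall A B C D,
    gassoc A B (gt C D) ∘ gassoc (gt A B) C D =
    gtm (fid A) (gassoc B C D) ∘ gassoc A (gt B C) D ∘ gtm (gassoc A B C) (fid D);
  gtriangle : forall A B,
    gtm (fid A) (glun B) ∘ gassoc A (disk 0) B = gtm (grun A) (fid B)
}.

(* Naturality is only required in the remaining variable: it makes
   [hom_oplax B C] and [hom_lax A C] functorial in all their arguments. *)
Record biclosed (M : monoidal) := Biclosed {
  hom_oplax : ooCat -> ooCat -> ooCat;
  oplax_curry : forall A B C, ooFun (gt M A B) C -> ooFun A (hom_oplax B C);
  oplax_uncurry : forall A B C, ooFun A (hom_oplax B C) -> ooFun (gt M A B) C;
  oplax_curryK : forall A B C, cancel (@oplax_curry A B C) (@oplax_uncurry A B C);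
  oplax_uncurryK : forall A B C, cancel (@oplax_uncurry A B C) (@oplax_curry A B C);
  oplax_curry_nat : forall A A' B C (f : ooFun A' A) (g : ooFun (gt M A B) C),
    oplax_curry (g ∘ gtm M f (fid B)) = oplax_curry g ∘ f;
  hom_lax : ooCat -> ooCat -> ooCat;
  lax_curry : forall A B C, ooFun (gt M A B) C -> ooFun B (hom_lax A C);
  lax_uncurry : forall A B C, ooFun B (hom_lax A C) -> ooFun (gt M A B) C;
  lax_curryK : forall A B C, cancel (@lax_curry A B C) (@lax_uncurry A B C);
  lax_uncurryK : forall A B C, cancel (@lax_uncurry A B C) (@lax_curry A B C);
  lax_curry_nat : forall A B B' C (f : ooFun B' B) (g : ooFun (gt M A B) C),
    lax_curry (g ∘ gtm M (fid A) f) = lax_curry g ∘ f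
}.

(* A structure of (strong) monoidal functor on the restriction of [nu] to strong
   Steiner complexes. These complexes are closed under tensor product, so that
   [hKL] and [hLP] below always exist. *)
Record nu_monoidal (M : monoidal) := NuMonoidal {
  mu : forall K L, strong_Steiner K -> strong_Steiner L ->
    ooFun (gt M (nu K) (nu L)) (nu (adc_tens K L));
  mu_inv : forall K L, strong_Steiner K -> strong_Steiner L ->
    ooFun (nu (adc_tens K L)) (gt M (nu K) (nu L));
  muK : forall K L (hK : strong_Steiner K) (hL : strong_Steiner L),
    fcancel (mu hK hL) (mu_inv hK hL);
  mu_nat : forall K K' L L' (hK : strong_Steiner K) (hK' : strong_Steiner K')
      (hL : strong_Steiner L) (hL' : strong_Steiner L')
      (f : adcHom K K') (g : adcHom L L'),
    mu hK' hL' ∘ gtm M (nu_map f) (nu_map g) =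
    nu_map (adc_tens_map f g) ∘ mu hK hL;
  mu_assoc : forall K L P (hK : strong_Steiner K) (hL : strong_Steiner L)
      (hP : strong_Steiner P) (hKL : strong_Steiner (adc_tens K L))
      (hLP : strong_Steiner (adc_tens L P)),
    nu_map (adc_assoc K L P) ∘ mu hKL hP ∘ gtm M (mu hK hL) (fid (nu P)) =
    mu hK hLP ∘ gtm M (fid (nu K)) (mu hL hP) ∘ gassoc M (nu K) (nu L) (nu P);
  mu_unit : ooFun (disk 0) (nu adc_unit);
  mu_unit_inv : ooFun (nu adc_unit) (disk 0);
  mu_unitK : fcancel mu_unit mu_unit_inv;
  mu_lun : forall K (hI : strong_Steiner adc_unit) (hK : strong_Steiner K),
    nu_map (adc_lunit K) ∘ mu hI hK ∘ gtm M mu_unit (fid (nu K)) =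
    glun M (nu K);
  mu_run : forall K (hI : strong_Steiner adc_unit) (hK : strong_Steiner K),
    nu_map (adc_runit K) ∘ mu hK hI ∘ gtm M (fid (nu K)) mu_unit =
    grun M (nu K)
}.

(* Such a structure is unique up to unique monoidal isomorphism. The unit is
   taken to be [D_0] on the nose in [monoidal]. *)
Record grayTensor := GrayTensor {
  gray_monoidal :> monoidal;
  gray_closed :> biclosed gray_monoidal;
  gray_nu :> nu_monoidal gray_monoidal
}.

Section Oplax.
Variable G : grayTensor.

(* The restrictions of [α : D_1 ⊗ A -> B] along [σ ⊗ A] and [τ ⊗ A], the unit
   constraint identifying [D_0 ⊗ A] with [A]. *)
Definition tr_src A B (a : ooFun (gt G (disk 1) A) B) : ooFun A B :=
  a ∘ gtm G (globe_src 0) (fid A) ∘ glun_inv G A.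
Definition tr_tgt A B (a : ooFun (gt G (disk 1) A) B) : ooFun A B :=
  a ∘ gtm G (globe_tgt 0) (fid A) ∘ glun_inv G A.

Record oplax A B (u v : ooFun A B) := Oplax {
  tr :> ooFun (gt G (disk 1) A) B;
  tr_srcE : tr_src tr = u;
  tr_tgtE : tr_tgt tr = v
}.

(* Currying identifies oo-functors [A -> B] with the [0]-cells of
   [hom_oplax A B], and oo-functors [D_1 ⊗ A -> B] with its [1]-cells. *)
Definition cell0 A B (u : ooFun A B) : hom_oplax G A B 0 :=
  oplax_curry G (u ∘ glun G A) 0 (disk_top 0).
Definition cell1 A B (a : ooFun (gt G (disk 1) A) B) : hom_oplax G A B 1 :=
  oplax_curry G a 1 (disk_top 1).
Definition of_cell1 A B (x : hom_oplax G A B 1) : ooFun (gt G (disk 1) A) B :=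
  oplax_uncurry (disk_map x).

Lemma cell1K A B : cancel (@cell1 A B) (@of_cell1 A B).
Proof. by move=> a; rewrite /of_cell1 /cell1 -disk_map_uniq oplax_curryK. Qed.

Lemma of_cell1K A B : cancel (@of_cell1 A B) (@cell1 A B).
Proof. by move=> x; rewrite /of_cell1 /cell1 oplax_uncurryK disk_map_top. Qed.

Lemma cell0_inj A B (u v : ooFun A B) : cell0 u = cell0 v -> u = v.
Proof.
rewrite /cell0 => e.
have {}e : u ∘ glun G A = v ∘ glun G A.
  apply: (can_inj (@oplax_curryK _ G _ _ _)).
  by rewrite [LHS]disk_map_uniq [RHS]disk_map_uniq e.
have [_ e'] := glunK G A.
by rewrite -[u]fcompid -[v]fcompid -e' !fcompA e.
Qed.

Lemma bd_cell1 e A B (a : ooFun (gt G (disk 1) A) B) :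
  bd e 0 (cell1 a) = cell0 (if e then tr_tgt a else tr_src a).
Proof.
have gl s : a ∘ gtm G s (fid A) ∘ glun_inv G A ∘ glun G A =
    a ∘ gtm G s (fid A).
  by rewrite -fcompA; have [-> _] := glunK G A; rewrite fcompid.
rewrite /cell0; case: e; rewrite gl oplax_curry_nat /cell1 -fun_bd;
  by congr (oplax_curry _ _ _ _); rewrite disk_map_top.
Qed.

Lemma tr_composable A B (u v w : ooFun A B) (b : oplax v w) (a : oplax u v) :
  composable 0 (cell1 b) (cell1 a).
Proof. by split=> //; rewrite !bd_cell1 tr_srcE tr_tgtE. Qed.

Definition vcomp A B (u v w : ooFun A B) (b : oplax v w) (a : oplax u v) :
  oplax u w.
Proof.
exists (of_cell1 (comp (tr_composable b a))); apply: cell0_inj.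
- by rewrite -(bd_cell1 false) of_cell1K src_comp bd_cell1 tr_srcE.
- by rewrite -(bd_cell1 true) of_cell1K tgt_comp bd_cell1 tr_tgtE.
Defined.

Definition tr_id A B (u : ooFun A B) : oplax u u.
Proof.
exists (of_cell1 (bd false 1 (cell0 u))); apply: cell0_inj.
- by rewrite -(bd_cell1 false) of_cell1K bd_bd // bd_id.
- by rewrite -(bd_cell1 true) of_cell1K bd_bd // bd_id.
Defined.

Lemma glun_inv_nat A A' (f : ooFun A A') :
  gtm G (fid (disk 0)) f ∘ glun_inv G A = glun_inv G A' ∘ f.
Proof.
have [gA' _] := glunK G A'; have [_ gA] := glunK G A.
rewrite -[LHS]fidcomp -gA' -fcompA; congr (_ ∘ _).
by rewrite fcompA glun_nat -fcompA gA fcompid.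
Qed.

Lemma gtm_swap A A' B B' (f : ooFun A A') (g : ooFun B B') :
  gtm G (fid A') g ∘ gtm G f (fid B) = gtm G f (fid B') ∘ gtm G (fid A) g.
Proof. by rewrite -!gtm_comp !fcompid !fidcomp. Qed.

Lemma tr_src_whisker T A B (a : ooFun (gt G (disk 1) A) B) (y : ooFun T A) :
  tr_src (a ∘ gtm G (fid (disk 1)) y) = tr_src a ∘ y.
Proof.
rewrite /tr_src -!fcompA; congr (_ ∘ _).
by rewrite fcompA gtm_swap -fcompA glun_inv_nat.
Qed.

Lemma tr_tgt_whisker T A B (a : ooFun (gt G (disk 1) A) B) (y : ooFun T A) :
  tr_tgt (a ∘ gtm G (fid (disk 1)) y) = tr_tgt a ∘ y.
Proof.
rewrite /tr_tgt -!fcompA; congr (_ ∘ _).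
by rewrite fcompA gtm_swap -fcompA glun_inv_nat.
Qed.

Definition whisker T A B (u v : ooFun A B) (a : oplax u v) (y : ooFun T A) :
  oplax (u ∘ y) (v ∘ y).
Proof.
exists (a ∘ gtm G (fid (disk 1)) y).
- by rewrite tr_src_whisker tr_srcE.
- by rewrite tr_tgt_whisker tr_tgtE.
Defined.

Lemma whisker_comp S T A B (u v : ooFun A B) (a : oplax u v) (y : ooFun T A)
    (z : ooFun S T) :
  tr (whisker a (y ∘ z)) = tr (whisker a y) ∘ gtm G (fid (disk 1)) z.
Proof. by rewrite /= -fcompA -gtm_comp fcompid. Qed.

Lemma vcomp_congr A B (u v w u' v' w' : ooFun A B)
    (b : oplax v w) (a : oplax u v) (b' : oplax v' w') (a' : oplax u' v') :
  tr b = tr b' -> tr a = tr a' -> tr (vcomp b a) = tr (vcomp b' a').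
Proof.
by move=> eb ea /=; congr of_cell1; apply: comp_congr; rewrite ?eb ?ea.
Qed.

Lemma vcomp_whisker T A B (u v w : ooFun A B) (b : oplax v w) (a : oplax u v)
    (y : ooFun T A) :
  tr (whisker (vcomp b a) y) = tr (vcomp (whisker b y) (whisker a y)).
Proof.
pose ev := oplax_uncurry (fid (hom_oplax G A B)).
pose Y := oplax_curry G (ev ∘ gtm G (fid _) y).
have YE c : cell1 (c ∘ gtm G (fid (disk 1)) y) = Y 1 (cell1 c).
  suff e : oplax_curry G (c ∘ gtm G (fid (disk 1)) y) = Y ∘ oplax_curry G c.
    by rewrite /cell1 e.
  rewrite -oplax_curry_nat -fcompA gtm_swap fcompA; congr (oplax_curry _ (_ ∘ _)).
  apply: (can_inj (@oplax_curryK _ G _ _ _)).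
  by rewrite oplax_curry_nat oplax_uncurryK fidcomp.
apply: (can_inj (@cell1K T B)); rewrite /= YE !of_cell1K.
rewrite (fun_comp _ (fun_composable Y (tr_composable b a))).
by apply: comp_congr; rewrite -YE.
Qed.

Definition tr_cast A B (u u' v v' : ooFun A B) (eu : u = u') (ev : v = v')
  (a : oplax u v) : oplax u' v' :=
  @Oplax A B u' v' a (etrans (tr_srcE a) eu) (etrans (tr_tgtE a) ev).

Definition strong_left_retract A B (i : ooFun A B) : Prop :=
  exists2 r : ooFun B A, r ∘ i = fid A &
  exists a : oplax (i ∘ r) (fid B), tr (whisker a i) = tr (tr_id i).

Definition strong_right_retract A B (i : ooFun A B) : Prop :=
  exists2 r : ooFun B A, r ∘ i = fid A &
  exists a : oplax (fid B) (i ∘ r), tr (whisker a i) = tr (tr_id i).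

(* The oo-functors [π_0] and [π_1] from [hom_lax D_1 C] to
   [hom_lax D_0 C = C]. *)
Definition lax_ev C : ooFun (gt G (disk 1) (hom_lax G (disk 1) C)) C :=
  lax_uncurry (fid (hom_lax G (disk 1) C)).
Definition lax_src C : ooFun (hom_lax G (disk 1) C) C := tr_src (lax_ev C).
Definition lax_tgt C : ooFun (hom_lax G (disk 1) C) C := tr_tgt (lax_ev C).

Lemma lax_uncurryE T C (f : ooFun T (hom_lax G (disk 1) C)) :
  lax_uncurry f = lax_ev C ∘ gtm G (fid (disk 1)) f.
Proof.
apply: (can_inj (@lax_curryK _ G _ _ _)).
by rewrite lax_uncurryK lax_curry_nat lax_uncurryK fidcomp.
Qed.

(* [c\A = D_0 ×_C Hom_lax(D_1, C) ×_C A]. *)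
Definition slice (A C : ooCat) (c : C 0) (v : ooFun A C) : ooCat :=
  fibprod (lax_tgt C ∘ fib_snd (disk_map c) (lax_src C)) v.

Section SlicePoints.
Variables (A C : ooCat) (c : C 0) (v : ooFun A C).

Definition slice_obj : ooFun (slice c v) A := fib_snd _ _.

Definition slice_tr : oplax (fconst (slice c v) c) (v ∘ slice_obj).
Proof.
exists (lax_uncurry (fib_snd _ _ ∘ fib_fst _ _)).
- rewrite lax_uncurryE tr_src_whisker -/(lax_src C) fcompA -fib_sq.
  by rewrite -fcompA; congr (_ ∘ _); apply: to_disk0_uniq.
- by rewrite lax_uncurryE tr_tgt_whisker -/(lax_tgt C) fcompA [LHS]fib_sq.
Defined.

Lemma whisker_slice_tr T (F : ooFun T (slice c v)) :
  tr (whisker slice_tr F) = lax_uncurry (fib_snd _ _ ∘ fib_fst _ _ ∘ F).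
Proof.
apply: (can_inj (@lax_curryK _ G _ _ _)).
by rewrite [LHS]lax_curry_nat !lax_uncurryK.
Qed.

Section Pair.
Variables (T : ooCat) (y : ooFun T A) (l : oplax (fconst T c) (v ∘ y)).

Lemma slice_pair_src : disk_map c ∘ to_disk0 T = lax_src C ∘ lax_curry G l.
Proof.
by rewrite -tr_src_whisker -lax_uncurryE lax_curryK tr_srcE.
Qed.

Lemma slice_pair_tgt :
  lax_tgt C ∘ fib_snd (disk_map c) (lax_src C) ∘ fib_pair slice_pair_src =
  v ∘ y.
Proof.
rewrite -fcompA fib_snd_pair -tr_tgt_whisker -lax_uncurryE lax_curryK.
exact: tr_tgtE.
Qed.

(* The oo-functor [T -> c\A] corresponding to the pair [(y, l)]. *)
Definition slice_pair : ooFun T (slice c v) := fib_pair slice_pair_tgt.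

Lemma slice_obj_pair : slice_obj ∘ slice_pair = y.
Proof. exact: fib_snd_pair. Qed.

Lemma slice_tr_pair : tr (whisker slice_tr slice_pair) = tr l.
Proof.
rewrite whisker_slice_tr -fcompA fib_fst_pair fib_snd_pair.
exact: lax_curryK.
Qed.

End Pair.

Lemma slice_ext T (F F' : ooFun T (slice c v)) :
  slice_obj ∘ F = slice_obj ∘ F' ->
  tr (whisker slice_tr F) = tr (whisker slice_tr F') -> F = F'.
Proof.
move=> eo; rewrite !whisker_slice_tr => /(can_inj (@lax_uncurryK _ G _ _ _)) et.
apply: fib_ext => //; apply: fib_ext; first exact: to_disk0_uniq.
by rewrite !fcompA.
Qed.

End SlicePoints.

(* For [w u = v], the oo-functor [c\A -> c\B], [(y, l) |-> (u y, l)]. *)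
Definition slice_tri (A B C : ooCat) (u : ooFun A B) (v : ooFun A C) (w : ooFun B C)
    (e : w ∘ u = v) (c : C 0) : ooFun (slice c v) (slice c w) :=
  slice_pair
    (tr_cast erefl
       (etrans (congr1 (fun z => z ∘ slice_obj c v) (esym e))
               (esym (fcompA w u (slice_obj c v))))
       (slice_tr c v)).

(* For [a : v => w u], the oo-functor [c\(u, a) : c\A -> c\B],
   [(y, l) |-> (u y, (a * y) l)]. *)
Definition slice_map (A B C : ooCat) (u : ooFun A B) (v : ooFun A C) (w : ooFun B C)
    (a : oplax v (w ∘ u)) (c : C 0) : ooFun (slice c v) (slice c w) :=
  slice_pair
    (tr_cast erefl (esym (fcompA w u (slice_obj c v)))
       (vcomp (whisker a (slice_obj c v)) (slice_tr c v))).

Lemma slice_tri_pair (A B C : ooCat) (u : ooFun A B) (v : ooFun A C) (w : ooFun B C)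
    (e : w ∘ u = v) (c : C 0) (T : ooCat) (y : ooFun T A)
    (l : oplax (fconst T c) (v ∘ y)) (l' : oplax (fconst T c) (w ∘ (u ∘ y))) :
  tr l' = tr l ->
  slice_tri e c ∘ slice_pair l = slice_pair l'.
Proof.
move=> el; apply: slice_ext.
  by rewrite slice_obj_pair fcompA slice_obj_pair -fcompA slice_obj_pair.
rewrite slice_tr_pair el whisker_comp slice_tr_pair.
exact: slice_tr_pair.
Qed.

Lemma slice_map_pair (A B C : ooCat) (u : ooFun A B) (v : ooFun A C) (w : ooFun B C)
    (a : oplax v (w ∘ u)) (c : C 0) (T : ooCat) (y : ooFun T A)
    (l : oplax (fconst T c) (v ∘ y)) (l' : oplax (fconst T c) (w ∘ (u ∘ y))) :
  tr l' = tr (vcomp (whisker a y) l) ->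
  slice_map a c ∘ slice_pair l = slice_pair l'.
Proof.
move=> el; apply: slice_ext.
  by rewrite slice_obj_pair fcompA slice_obj_pair -fcompA slice_obj_pair.
rewrite slice_tr_pair el whisker_comp slice_tr_pair.
rewrite [LHS]vcomp_whisker; apply: vcomp_congr; last exact: slice_tr_pair.
by rewrite -[LHS]whisker_comp slice_obj_pair.
Qed.

End Oplax.

(* Main.v *)
From HB Require Import structures.
From mathcomp Require Import all_boot all_order all_algebra.
From mathcomp Require Import finmap boolp zify.
From Stdlib Require Import Relation_Operators.
Require Import Defs.

Set Implicit Arguments.
Unset Strict Implicit.
Unset Printing Implicit Defensive.

Import Order.TTheory GRing.Theory Num.Theory.

Local Open Scope oocat_scope.

(* Factor [u] as [A -> C ↓ w -> B], through the comma oo-category whose objects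
   are the triples [(x, b, x -> w b)], the first oo-functor being given by [v],
   [u] and [α]. The projection [C ↓ w -> B] is in W, because its section
   [b |-> (w b, b, id)] is a strong right retract. The oo-functor [A -> C ↓ w] lies
   over [C], so by Theorem A for commutative triangles it remains to see that
   [c\A -> c\(C ↓ w)] is in W. Its composite with the composition oo-functor
   [c\(C ↓ w) -> c\B], [(c -> x -> w b) |-> (c -> w b)], is [c\(u, α)], and the
   composition oo-functor is in W because its section
   [(c -> w b) |-> (c = c -> w b)] is a strong left retract.
   The transformations exhibiting the two retracts are built from the connections
   [max, min : D_1 ⊗ D_1 -> D_1], which are the images under [ν] of morphisms of
   strong Steiner complexes. *)

(** * Coherence of the unit constraints *)

Lemma fcancel_epi (A B C : ooCat) (F : ooFun A B) (F' : ooFun B A) (g h : ooFun B C) :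
  fcancel F F' -> g ∘ F = h ∘ F -> g = h.
Proof.
by case=> _ FK e; rewrite -[g]fcompid -[h]fcompid -FK !fcompA e.
Qed.

Lemma fconst_comp (S T C : ooCat) (c : C 0) (f : ooFun S T) :
  fconst T c ∘ f = fconst S c.
Proof. by rewrite /fconst -fcompA; congr (_ ∘ _); apply: to_disk0_uniq. Qed.

Section Coherence.
Variable M : monoidal.

Lemma gtm_fuse A A' A'' B B' B'' (f : ooFun A A') (f' : ooFun A' A'')
    (g : ooFun B B') (g' : ooFun B' B'') :
  gtm M f' g' ∘ gtm M f g = gtm M (f' ∘ f) (g' ∘ g).
Proof. by rewrite gtm_comp. Qed.

Lemma gtm_cancel A A' B B' (f : ooFun A A') f' (g : ooFun B B') g' :
  fcancel f f' -> fcancel g g' -> fcancel (gtm M f g) (gtm M f' g').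
Proof.
by move=> [f1 f2] [g1 g2]; split; rewrite gtm_fuse ?f1 ?f2 ?g1 ?g2 gtm_id.
Qed.

Lemma fid_cancel A : fcancel (fid A) (fid A).
Proof. by split; rewrite fcompid. Qed.

(** The unit constraint is a natural isomorphism, so tensoring with [D_0] is faithful. *)
Lemma gtm_unit_inj A B (f g : ooFun A B) :
  gtm M (fid (disk 0)) f = gtm M (fid (disk 0)) g -> f = g.
Proof. by move=> e; apply: (fcancel_epi (glunK M A)); rewrite -!glun_nat e. Qed.

(* Kelly's redundant axiom: after tensoring on the left with the unit, both
   sides are identified by the pentagon and the triangle. *)
Lemma glun_assoc A B :
  glun M (gt M A B) ∘ gassoc M (disk 0) A B = gtm M (glun M A) (fid B).
Proof.
apply: gtm_unit_inj.
apply: (fcancel_epi (gassocK M (disk 0) (gt M (disk 0) A) B)).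
apply: (fcancel_epi (gtm_cancel (gassocK M (disk 0) (disk 0) A) (fid_cancel B))).
have := congr1 (fun F => gtm M (fid (disk 0)) (glun M (gt M A B)) ∘ F)
  (gpentagon M (disk 0) (disk 0) A B).
rewrite !fcompA gtriangle gtm_fuse fidcomp => <-.
rewrite -gassoc_nat -fcompA gtm_fuse gtriangle fidcomp.
by rewrite -[fid (gt M A B)]gtm_id gassoc_nat.
Qed.

Lemma gassoc_inv_nat A A' B B' C C'
    (f : ooFun A A') (g : ooFun B B') (h : ooFun C C') :
  gassoc_inv M A' B' C' ∘ gtm M f (gtm M g h) =
  gtm M (gtm M f g) h ∘ gassoc_inv M A B C.
Proof.
apply: (fcancel_epi (gassocK M A B C)).
rewrite -!fcompA -gassoc_nat (proj1 (gassocK M A B C)) fcompid.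
by rewrite fcompA (proj1 (gassocK M A' B' C')) fidcomp.
Qed.

Lemma glun_gassoc_inv A B :
  gtm M (glun M A) (fid B) ∘ gassoc_inv M (disk 0) A B = glun M (gt M A B).
Proof.
by rewrite -glun_assoc -fcompA (proj2 (gassocK M _ _ _)) fcompid.
Qed.

Lemma grun_gassoc_inv A B :
  gtm M (grun M A) (fid B) ∘ gassoc_inv M A (disk 0) B =
  gtm M (fid A) (glun M B).
Proof.
by rewrite -gtriangle -fcompA (proj2 (gassocK M _ _ _)) fcompid.
Qed.

End Coherence.

(** * The connections of the arrow *)

Local Open Scope ring_scope.

(** * Bases given by an explicit finite list *)

Section FiniteBasis.
Variables (G : zmodType) (B : G -> Prop) (s : seq G) (c : G -> G -> int).
Hypothesis Bs : forall b, B b <-> b \in s.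
Hypothesis s_uniq : uniq s.
Hypothesis cE : forall x, x = \sum_(b <- s) b *~ c x b.
Hypothesis cK : forall (g : G -> int) b, b \in s ->
  c (\sum_(b <- s) b *~ g b) b = g b.

(** Replaces the support of a coordinate function by the fixed list [s]: the elements of [s] outside
    the support contribute [F b 0 = 0]. *)
Lemma sum_finsupp (f : {fsfun G -> int with 0}) (F : G -> int -> G) :
  (forall b, f b <> 0 -> B b) -> (forall b, F b 0 = 0) ->
  \sum_(b <- finsupp f) F b (f b) = \sum_(b <- s) F b (f b).
Proof.
move=> fB F0.
have pe : perm_eq (finsupp f) [seq b <- s | b \in finsupp f].
  apply: uniq_perm; rewrite ?fset_uniq ?filter_uniq // => b.
  rewrite mem_filter; case: (boolP (b \in _)) => //= bf.
  by symmetry; apply/Bs/fB/eqP; rewrite -mem_finsupp.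
rewrite (perm_big _ pe) big_filter big_mkcond; apply: eq_bigr => b _.
by case: ifP => // /negbT /fsfun_dflt ->; rewrite F0.
Qed.

Lemma is_coordsE x f : is_coords B x f -> forall b, f b = if b \in s then c x b else 0.
Proof.
move=> [fB ->] b; rewrite (sum_finsupp (F := fun b m => b *~ m)) //.
case: ifP => [/cK -> //|bs]; apply: contrapT => /fB /Bs.
by rewrite bs.
Qed.

Lemma is_coords_ex x : exists f, is_coords B x f.
Proof.
pose f : {fsfun G -> int with 0} := [fsfun b in [fset b in s]%fset => c x b].
have fE b : f b = if b \in s then c x b else 0.
  by rewrite fsfunE in_fset /=.
have fB b : f b <> 0 -> B b by rewrite fE; case: ifP => // /Bs.
exists f; split=> //; rewrite (sum_finsupp (F := fun b m => b *~ m)) //.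
by rewrite {1}[x]cE; apply: eq_big_seq => b bs; rewrite fE bs.
Qed.

Lemma fin_zbasis : is_zbasis B.
Proof.
move=> x; have [f fx] := is_coords_ex x; exists f; split=> // g gx.
by apply/fsfunP => b; rewrite (is_coordsE fx) (is_coordsE gx).
Qed.

Lemma fin_coords x b : coords B x b = if b \in s then c x b else 0.
Proof.
rewrite /coords; case: pselect => [h|[]]; last exact: is_coords_ex.
exact: (is_coordsE (svalP (cid h))).
Qed.

Lemma fin_part e x :
  part B e x = \sum_(b <- s) b *~ Num.max (if e then c x b else - c x b) 0.
Proof.
rewrite /part (sum_finsupp (F := fun b m => b *~ Num.max (if e then m else - m) 0)).
- by apply: eq_big_seq => b bs; rewrite fin_coords bs.
- by move=> b; rewrite fin_coords; case: ifP => // /Bs.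
- by move=> b; rewrite oppr0; case: e; rewrite maxxx mulr0z.
Qed.

Lemma fin_submonoid x : gen_submonoid B x <-> forall b, b \in s -> 0 <= c x b.
Proof.
split.
  elim=> {x} [x Bx||x y _ xP _ yP] b bs.
  (* Since [cK] only reads coordinates off an explicit linear combination, each element is first
     written as one: here with the indicator function of [x]. *)
  - have -> : x = \sum_(b <- s) b *~ (b == x)%:Z.
      rewrite (bigD1_seq x) //=; last exact/Bs.
      by rewrite eqxx big1 ?addr0 // => i /negPf ->.
    by rewrite (cK (fun b => (b == x)%:Z)).
  - have -> : 0 = \sum_(b <- s) b *~ 0 by rewrite big1.
    by rewrite (cK (fun=> 0)).
  - have -> : x + y = \sum_(b <- s) b *~ (c x b + c y b).
      rewrite {1}[x]cE {1}[y]cE -big_split; apply: eq_bigr => i _.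
      by rewrite mulrzDr.
    by rewrite (cK (fun b => c x b + c y b)) // addr_ge0 ?xP ?yP.
move=> xP; rewrite [x]cE big_seq; apply: big_ind => [||b bs]; first exact: gen_zero.
  exact: gen_add.
have /Bs Bb := bs; case: (c x b) (xP b bs) => // n _.
elim: n => [|n IHn]; first by rewrite mulr0z; apply: gen_zero.
by rewrite -pmulrn mulrS; apply: gen_add => //; apply: gen_mem.
Qed.

End FiniteBasis.

(** A nontrivial path of basis steps strictly raises the rank, so no path leads back. *)
Lemma ranked_loop_free (K : adc) (B : forall i, K i -> Prop)
    (r : {i : nat & K i} -> nat) :
  (forall p q, basis_step B p q -> (r p < r q)%N) -> strongly_loop_free B.
Proof.
move=> rlt.
have rle p q : clos_refl_trans _ (basis_step B) p q -> p = q \/ (r p < r q)%N.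
  elim=> [p' q' /rlt|p'|p' q' t _ [->//|pq] _ [<-|qt]]; [by right|by left|by right|].
  by right; apply: ltn_trans qt.
by move=> p q /rle [//|pq] /rle [//|/(ltn_trans pq)]; rewrite ltnn.
Qed.

(** * The unit complex *)

Lemma rV0_eq (x y : 'rV[int]_0) : x = y.
Proof. by apply/rowP => -[]. Qed.

Definition unit_basis i : seq (unit_grp i) :=
  if i is 0 then [:: 1 : int] else [::].

Definition unit_coord i : unit_grp i -> unit_grp i -> int :=
  if i is 0 then fun x _ => x else fun _ _ => 0.

Lemma strong_Steiner_unit : strong_Steiner adc_unit.
Proof.
pose B i (b : adc_unit i) := b \in unit_basis i.
have sU i : uniq (unit_basis i) by case: i.
have cE i x : x = \sum_(b <- unit_basis i) b *~ unit_coord x b.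
  by case: i x => [|i] x; rewrite ?big_nil ?big_seq1 /= ?intz //; apply: rV0_eq.
have cK i (g : unit_grp i -> int) b : b \in unit_basis i ->
    unit_coord (\sum_(b <- unit_basis i) b *~ g b) b = g b.
  by case: i g b => // g b /=; rewrite inE => /eqP ->; rewrite big_seq1 intz.
have BB i (b : adc_unit i) : B i b <-> b \in unit_basis i by [].
exists B; split.
- split=> i; first exact: (fin_zbasis (@BB i) (sU i) (@cE i) (@cK i)).
  move=> x; apply: iff_trans (iff_sym (fin_submonoid (@BB i) (sU i) (@cE i) (@cK i) x)).
  case: i x => //= x; split=> [x0 b //|/(_ 1)].
  by rewrite inE; apply.
- by move=> e [|i] b //; rewrite /B inE => /eqP ->.
- by apply: (ranked_loop_free (r := fun=> 0%N)) => p q [].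
Qed.

(** * The complex of the arrow *)

(** In degree 0, a pair holds the coefficients of the source vertex and of the target vertex, in
    this order; row vectors of length 0 serve as the zero group above degree 1. *)
Definition arrow_grp (i : nat) : zmodType :=
  match i with
  | 0 => (int * int)%type : zmodType
  | 1 => int : zmodType
  | _ => 'rV[int]_0
  end.

Definition arrow_diff0 (x : int) : int * int := (- x, x).

Lemma arrow_diff0_additive : {morph arrow_diff0 : x y / x - y}.
Proof. by move=> x y; rewrite /arrow_diff0 opprD. Qed.

HB.instance Definition _ :=
  GRing.isZmodMorphism.Build int (int * int)%type arrow_diff0 arrow_diff0_additive.

Definition arrow_diff i : {additive arrow_grp i.+1 -> arrow_grp i} :=
  if i is 0 then arrow_diff0 : {additive int -> (int * int)%type} else \0.

Definition arrow_aug (x : int * int) : int := x.1 + x.2.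

Lemma arrow_aug_additive : {morph arrow_aug : x y / x - y}.
Proof. by move=> x y; rewrite /arrow_aug /=; lia. Qed.

HB.instance Definition _ :=
  GRing.isZmodMorphism.Build (int * int)%type int arrow_aug arrow_aug_additive.

Definition arrow_pos i : arrow_grp i -> Prop :=
  match i with
  | 0 => fun x : int * int => 0 <= x.1 /\ 0 <= x.2
  | 1 => fun x : int => 0 <= x
  | _ => fun=> True
  end.

(* The complex of the oo-category [D_1]. *)
Definition arrow : adc.
Proof.
refine (@Adc arrow_grp arrow_diff (arrow_aug : {additive (int * int)%type -> int}) arrow_pos _ _ _ _).
- by case=> [|i] x.
- by move=> x; rewrite [LHS]addNr.
- by case=> [|[|i]].
- by case=> [|[|i]] //= x y; lia.
Defined.

Definition arrow_basis i : seq (arrow_grp i) :=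
  match i with
  | 0 => [:: (1, 0) : int * int; (0, 1) : int * int]
  | 1 => [:: 1 : int]
  | _ => [::]
  end.

Definition arrow_coord i : arrow_grp i -> arrow_grp i -> int :=
  match i with
  | 0 => fun x b : int * int => if b == (1, 0) then x.1 else x.2
  | 1 => fun (x : int) _ => x
  | _ => fun _ _ => 0
  end.

Lemma pairMz (x y m : int) : (x, y) *~ m = (x * m, y * m).
Proof.
have E (n : nat) : (x, y) *+ n = (x * n%:Z, y * n%:Z) :> (int * int)%type.
  elim: n => [|n IHn]; first by rewrite !mulr0.
  by rewrite mulrS IHn; congr pair => /=; lia.
case: m => n; first exact: E.
by rewrite NegzE mulrNz [_ *~ _]E; congr pair => /=; lia.
Qed.

(** Orders the basis as source, edge, target. Only the values at basis elements matter. *)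
Definition arrow_rank (p : {i : nat & arrow i}) : nat :=
  match p with
  | existT 0%N x => if (x : (int * int)%type) == (1, 0) then 0%N else 2%N
  | _ => 1%N
  end.

Lemma strong_Steiner_arrow : strong_Steiner arrow.
Proof.
pose B i (b : arrow i) := b \in arrow_basis i.
have sU i : uniq (arrow_basis i) by case: i => [|[|i]].
have cE i x : x = \sum_(b <- arrow_basis i) b *~ arrow_coord x b.
  case: i x => [|[|i]] x; rewrite ?big_nil ?big_seq1 /= ?intz //; last exact: rV0_eq.
  rewrite big_cons big_seq1 !pairMz /=; case: x => x y.
  by congr pair => /=; lia.
have cK i (g : arrow_grp i -> int) b : b \in arrow_basis i ->
    arrow_coord (\sum_(b <- arrow_basis i) b *~ g b) b = g b.
  case: i g b => [|[|i]] g b //=; last by rewrite inE => /eqP ->; rewrite big_seq1 intz.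
  rewrite big_cons big_seq1 !pairMz !inE => /orP[]/eqP -> /=; lia.
have BB i (b : arrow i) : B i b <-> b \in arrow_basis i by [].
(* The boundary of the edge is target minus source; this gives both unitality and the order on the
   basis. *)
have pE e : part (B 0%N) e (diff (1 : arrow 1)) = if e then (0, 1) else (1, 0).
  rewrite (fin_part (@BB 0%N) (sU _) (@cE 0%N) (@cK 0%N)).
  by rewrite big_cons big_seq1 !pairMz /=; case: e.
exists B; split.
- split=> i; first exact: (fin_zbasis (@BB i) (sU i) (@cE i) (@cK i)).
  move=> x; apply: iff_trans (iff_sym (fin_submonoid (@BB i) (sU i) (@cE i) (@cK i) x)).
  case: i x => [|[|i]] //= x; split.
  + by case=> x1 x2 b; rewrite !inE => /orP[]/eqP ->.
  + by move=> xP; split; [apply: (xP (1, 0)) | apply: (xP (0, 1))].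
  + by move=> x0 b.
  + by move/(_ 1); apply; rewrite inE.
- move=> e [|[|i]] b //.
  + by rewrite /B !inE => /orP[]/eqP ->.
  + rewrite /B inE => /eqP -> /=; rewrite pE; by case: e.
- apply: (ranked_loop_free (r := arrow_rank)).
  move=> p q [[|i] x y Bx|[|i] x y Bx] //; move: (Bx); rewrite /B inE => /eqP ->;
    rewrite pE /in_supp (fin_coords (@BB 0%N) (sU _) (@cE 0%N) (@cK 0%N));
    by rewrite !inE; case: (y =P (1, 0)) => [->|] //=; case: (y =P (0, 1)) => [->|].
Qed.

(** * The isomorphism between [D_1] and the image of the arrow under ν *)

Lemma disk_ext (C : ooCat) n (F F' : ooFun (disk n) C) :
  F n (disk_top n) = F' n (disk_top n) -> F = F'.
Proof. by move=> e; rewrite (disk_map_uniq F) (disk_map_uniq F') e. Qed.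

(** Chosen preimages commute with boundaries and compositions, as can be tested after applying the
    injective [F]. *)
Lemma ooFun_bij (A B : ooCat) (F : ooFun A B) :
  (forall i, injective (F i)) -> (forall i y, exists x, F i x = y) ->
  exists F', fcancel F F'.
Proof.
move=> Finj Fsurj.
pose f i y : A i := sval (cid (Fsurj i y)).
have fK i y : F i (f i y) = y := svalP (cid (Fsurj i y)).
have f_bd e i j y : f j (bd e j y) = bd e j (f i y).
  by apply: Finj; rewrite fun_bd !fK.
have f_comp j i (x y : B i) (h : composable j x y) (h' : composable j (f i x) (f i y)) :
    f i (comp h) = comp h'.
  apply: Finj; rewrite fK (fun_comp _ (fun_composable F h')).
  by apply: comp_congr; rewrite fK.
exists (OoFun f_bd f_comp); split; apply: ooFun_ext => i x /=.
  by apply: Finj; rewrite fK.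
exact: fK.
Qed.

Definition adc_id (K : adc) : adcHom K K.
Proof. by exists (fun i => idfun : {additive K i -> K i}). Defined.

Lemma nu_map_id (K : adc) : nu_map (adc_id K) = fid (nu K).
Proof. by apply: ooFun_ext => i x; apply: tab_eq. Qed.

Lemma nu_map_ext (K L M N : adc) (f : adcHom K L) (g : adcHom L N)
    (f' : adcHom K M) (g' : adcHom M N) :
  (forall n x, g n (f n x) = g' n (f' n x)) ->
  nu_map g ∘ nu_map f = nu_map g' ∘ nu_map f'.
Proof. by move=> e; apply: ooFun_ext => i x; apply: tab_eq => a k; apply: e. Qed.

(** The differential of the arrow is injective in degree 1, so the edge coefficient is read off the
    difference of the two vertices. *)
Lemma arrow_tab_eq i (x y : table arrow i) :
  (forall e, x e 0%N = y e 0%N) -> x = y.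
Proof.
move=> e0; apply: tab_eq => e [|[|k]] //; last exact: rV0_eq.
by have := tab_diff x e 0; rewrite !e0 -(tab_diff y e 0) => -[].
Qed.

(** Nonnegative coefficients with sum 1 leave only the two basis vertices. *)
Lemma arrow_tab0 i (x : table arrow i) e :
  x e 0%N = if (x e 0%N : (int * int)%type) == (1, 0) then (1, 0) else (0, 1).
Proof.
case: eqP => [//|]; have := tab_aug x e; have := tab_pos x e 0.
case: (x e 0%N) => p q [/= p0 q0]; rewrite /arrow_aug /= => pq ne.
have p00 : p = 0.
  by apply: contrapT => p0'; apply: ne; congr pair; lia.
by congr pair; lia.
Qed.

(** A table going from the target vertex to the source vertex would have edge coefficient -1,
    against positivity. *)
Lemma arrow_tab_le i (x : table arrow i) :
  x true 0%N = (1, 0) -> x false 0%N = (1, 0).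
Proof.
move=> xt; rewrite arrow_tab0; case: eqP => // ne.
have := tab_diff x true 0; rewrite [x false _]arrow_tab0; case: eqP => // _.
have := tab_pos x true 1; rewrite xt.
move: (x true 1%N : int) => /= p p0 [].
lia.
Qed.

Definition arrow_tab (e : bool) (k : nat) : arrow k :=
  match k with
  | 0 => if e then (0, 1) else (1, 0)
  | 1 => 1 : int
  | _ => 0
  end.

Definition arrow_top : nu arrow 1.
Proof.
exists arrow_tab => //.
- by case=> [] [|[|k]].
- by case=> [] [|k] //; rewrite [RHS]subrr.
- by case.
- by move=> e [|[|k]].
Defined.

Definition disk_arrow : ooFun (disk 1) (nu arrow) := disk_map arrow_top.

Lemma disk_arrowE i (x : disk 1 i) e :
  (disk_arrow i x : table arrow i) e 0%N =
  if (val x).1 is 0%N then arrow_tab (val x).2 0 else arrow_tab e 0.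
Proof.
case: x => [[[|m] a] hm] /=; first by case: i {hm}.
have /andP[/= mi /eqP[m0 _]] := hm.
by case: i mi hm.
Qed.

(** A table is determined by its pair of vertices, and only three pairs occur: the two constant ones
    and (source, target). These match the cells of [D_1]. *)
Lemma disk_arrow_iso : exists F, fcancel disk_arrow F.
Proof.
apply: ooFun_bij => i.
  move=> x y exy.
  have E e : (disk_arrow i x : table arrow i) e 0%N =
      (disk_arrow i y : table arrow i) e 0%N by rewrite exy.
  have := E true; have := E false; rewrite !disk_arrowE {E exy}.
  case: x y => [[m a] hm] [[m' a'] hm'] /= e0 e1.
  apply: val_inj => /=; move: hm hm' e0 e1; rewrite /disk_pred /=.
  by case: m => [|[|m]]; case: m' => [|[|m']]; case: a a' => [] [] //=; rewrite ?andbF.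
move=> y.
have D m a (h : disk_pred 1 i (m, a)) :
    (forall e, y e 0%N = if m is 0%N then arrow_tab a 0 else arrow_tab e 0) ->
    exists x, disk_arrow i x = y.
  move=> ye; exists (exist _ (m, a) h); apply: arrow_tab_eq => e.
  by rewrite disk_arrowE.
have [ys|ys] := eqVneq (y false 0%N : (int * int)%type) (1, 0); last first.
  apply: (D 0%N true) => // -[]; rewrite arrow_tab0 ?(negPf ys) //.
  by case: eqP => // /arrow_tab_le /eqP; rewrite (negPf ys).
have [yt|yt] := eqVneq (y true 0%N : (int * int)%type) (1, 0).
  by apply: (D 0%N false) => // -[].
(* A table of dimension 0 has equal vertices, so the pair (source, target) needs positive dimension,
   as does the principal cell. *)
case: i y D ys yt => [|i] y D ys yt.
  by move: yt; rewrite -tab_top ys eqxx.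
apply: (D 1%N false) => // -[] //.
by rewrite arrow_tab0 (negPf yt).
Qed.

Definition arrow_disk : ooFun (nu arrow) (disk 1) := sval (cid disk_arrow_iso).

Lemma disk_arrowK : fcancel disk_arrow arrow_disk.
Proof. exact: (svalP (cid disk_arrow_iso)). Qed.

(** * Ends and connections at the level of complexes *)

Definition arrow_end0 (e : bool) (m : int) : int * int :=
  if e then (0, m) else (m, 0).

Lemma arrow_end0_additive e : {morph arrow_end0 e : x y / x - y}.
Proof. by case: e => x y; rewrite /arrow_end0; congr pair => /=; rewrite subr0. Qed.

HB.instance Definition _ e := GRing.isZmodMorphism.Build int (int * int)%type
  (arrow_end0 e) (@arrow_end0_additive e).

Definition arrow_end (e : bool) : adcHom adc_unit arrow.
Proof.
exists (fun i => if i is 0%N as i return {additive unit_grp i -> arrow_grp i}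
                 then arrow_end0 e : {additive int -> (int * int)%type} else \0).
- by case=> [|i] x; rewrite /= ?raddf0.
- by move=> x; case: e; rewrite /= /arrow_aug /= ?add0r ?addr0.
- by case=> [|[|i]] x //=; case: e.
Defined.

Definition arrow_to_unit : adcHom arrow adc_unit.
Proof.
exists (fun i => if i is 0%N as i return {additive arrow_grp i -> unit_grp i}
                 then arrow_aug : {additive (int * int)%type -> int} else \0).
- case=> [|i] x //=; rewrite /arrow_aug /=; lia.
- by [].
- by case=> [|i] x //= -[]; rewrite /arrow_aug; lia.
Defined.

Definition arrow_vertex (b : bool) (x : int * int) : int := if b then x.2 else x.1.

(* On vertices, [max] for [b = true] and [min] for [b = false], where the source
   of the arrow is smaller than its target; the 2-dimensional generator of the
   square is sent to [0]. *)
Definition arrow_mul (b : bool) n i j : arrow_grp i -> arrow_grp j -> arrow_grp n :=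
  match n, i, j with
  | 0, 0, 0 => fun x y : int * int =>
      if b then (x.1 * y.1, x.1 * y.2 + x.2 * (y.1 + y.2))
      else (x.1 * (y.1 + y.2) + x.2 * y.1, x.2 * y.2)
  | 1, 0, 1 => fun (x : int * int) (y : int) => arrow_vertex (~~ b) x * y
  | 1, 1, 0 => fun (x : int) (y : int * int) => x * arrow_vertex (~~ b) y
  | _, _, _ => fun _ _ => 0
  end.

Definition arrow_conn (b : bool) : adcHom (adc_tens arrow arrow) arrow.
Proof.
apply: (@adc_lift arrow arrow arrow (fun n i j _ => @arrow_mul b n i j)).
- move=> [|[|n]] [|[|i]] [|[|j]] h x x' y //=; rewrite ?addr0 //; case: b => /=;
    by (congr pair => /= || idtac); lia.
- move=> [|[|n]] [|[|i]] [|[|j]] h x y y' //=; rewrite ?addr0 //; case: b => /=;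
    by (congr pair => /= || idtac); lia.
- move=> fDl fDr n i j h x y.
  have tE m i' j' (g : (i' + j')%N = m) u v :
    tlift (@fDl m) (@fDr m) (tens g u v) = arrow_mul b m u v by exact: tliftE.
  have t0 m : tlift (@fDl m) (@fDr m) 0 = 0 by exact: raddf0.
  rewrite /dtens [RHS]raddfD [in RHS]raddfMz.
  case: n i j h x y => [|[|n]] [|[|[|i]]] [|[|[|j]]] h x y; try by discriminate h.
  all: rewrite ?tE ?t0 ?mul0rz ?add0r ?addr0 //.
  all: try exact: rV0_eq.
  1-5: clear tE t0 fDl fDr h.
  + by rewrite expr0 mulr1z; case: b => /=; congr pair; rewrite /arrow_vertex /=; lia.
  + by case: b => /=; congr pair; rewrite /arrow_vertex /=; lia.
  + by rewrite expr0 mulr1z [RHS]mulr0.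
  (* The square: the two terms of [dx ⊗ y - x ⊗ dy] have the same image, so sending the square to 0
     is compatible with the differential. *)
  + rewrite expr1 mulrNz mulr1z; case: b; rewrite [RHS]/= /arrow_vertex /=; lia.
  + by rewrite [RHS]mul0r.
- move=> [|i] [|j] h x y //=; rewrite /arrow_aug; case: b => /=; lia.
- move=> [|[|n]] [|[|i]] [|[|j]] h x y //=; case: b => /=; nia.
Defined.

Lemma arrow_connE b n i j (h : (i + j)%N = n) (x : arrow i) (y : arrow j) :
  arrow_conn b n (tens h x y) = arrow_mul b n x y.
Proof. exact: adc_liftE. Qed.

Lemma unit_grp0 i (x : unit_grp i.+1) : x = 0.
Proof. exact: rV0_eq. Qed.

Lemma tens_ext (K L : adc) (V : zmodType) n (f g : {additive adc_tens K L n -> V}) :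
  (forall i j (h : (i + j)%N = n) x y, f (tens h x y) = g (tens h x y)) ->
  forall t, f t = g t.
Proof.
move=> fg; elim/tens_ind => [|s t Ps Pt|t Pt|//]; rewrite ?raddf0 //.
  by rewrite [LHS]raddfD [RHS]raddfD Ps Pt.
by rewrite [LHS]raddfN [RHS]raddfN Pt.
Qed.

Lemma nu_map_tens_ext (K L M N P : adc) (f : adcHom (adc_tens K L) M) (g : adcHom M P)
    (f' : adcHom (adc_tens K L) N) (g' : adcHom N P) :
  (forall n i j (h : (i + j)%N = n) (x : K i) (y : L j),
    g n (f n (tens h x y)) = g' n (f' n (tens h x y))) ->
  nu_map g ∘ nu_map f = nu_map g' ∘ nu_map f'.
Proof.
move=> e; apply: nu_map_ext => n.
exact: (tens_ext (f := g n \o f n) (g := g' n \o f' n) (e n)).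
Qed.

Definition adc_comp (K L M : adc) (g : adcHom L M) (f : adcHom K L) : adcHom K M.
Proof.
exists (fun i => g i \o f i : {additive K i -> M i}).
- by move=> i x; rewrite /= !ahom_diff.
- by move=> x; rewrite /= !ahom_aug.
- by move=> i x px; do 2!apply: ahom_pos.
Defined.

Lemma nu_map_comp (K L M : adc) (g : adcHom L M) (f : adcHom K L) :
  nu_map g ∘ nu_map f = nu_map (adc_comp g f).
Proof. by apply: ooFun_ext => i x; apply: tab_eq. Qed.

(** The neutral vertex is the source for max and the target for min. The identity factor on the
    right gives the shape that [connection_endl] takes. *)
Lemma arrow_conn_idl b :
  nu_map (arrow_conn b) ∘ nu_map (adc_tens_map (arrow_end (~~ b)) (adc_id arrow)) =
  nu_map (adc_id arrow) ∘ nu_map (adc_lunit arrow).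
Proof.
apply: nu_map_tens_ext => n [|i] j h x y; last by rewrite (unit_grp0 x) tens0l !raddf0.
rewrite adc_tens_mapE arrow_connE.
case: j h y => [|[|j]] h y; case: n / h; last exact: rV0_eq.
  case: y => y1 y2; rewrite adc_lunitE [RHS]pairMz.
  by case: b; congr pair => /=; lia.
rewrite adc_lunitE [RHS](mulrzz y x).
by case: b; rewrite /= /arrow_vertex /= mulrC.
Qed.

(** The vertex [b] absorbs: target for max, source for min. Being constant there is expressed by
    factoring through the augmentation to the unit complex. *)
Lemma arrow_conn_absl b :
  nu_map (arrow_conn b) ∘ nu_map (adc_tens_map (arrow_end b) (adc_id arrow)) =
  nu_map (arrow_end b) ∘ nu_map arrow_to_unit ∘ nu_map (adc_lunit arrow).
Proof.
rewrite (nu_map_comp (arrow_end b)).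
apply: nu_map_tens_ext => n [|i] j h x y; last by rewrite (unit_grp0 x) tens0l !raddf0.
rewrite adc_tens_mapE arrow_connE.
case: j h y => [|[|j]] h y; case: n / h; last exact: rV0_eq.
  case: y => y1 y2; rewrite adc_lunitE.
  have aE : arrow_aug ((y1, y2) *~ x) = (y1 + y2) * x.
    by rewrite pairMz /arrow_aug /=; lia.
  by case: b => /=; rewrite aE; congr pair; lia.
by case: b; rewrite /= /arrow_vertex /= mul0r.
Qed.

Lemma arrow_conn_absr b :
  nu_map (arrow_conn b) ∘ nu_map (adc_tens_map (adc_id arrow) (arrow_end b)) =
  nu_map (arrow_end b) ∘ nu_map arrow_to_unit ∘ nu_map (adc_runit arrow).
Proof.
rewrite (nu_map_comp (arrow_end b)).
apply: nu_map_tens_ext => n i [|j] h x y; last by rewrite (unit_grp0 y) tens0r !raddf0.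
rewrite adc_tens_mapE arrow_connE.
have h' : i = n by rewrite -[i]addn0.
subst i; rewrite adc_runitE.
case: n h x => [|[|n]] h x; last exact: rV0_eq.
  case: x => x1 x2.
  have aE : arrow_aug ((x1, x2) *~ y) = (x1 + x2) * y.
    by rewrite pairMz /arrow_aug /=; lia.
  by case: b => /=; rewrite aE; congr pair; lia.
by case: b; rewrite /= /arrow_vertex /= mulr0.
Qed.

Lemma arrow_conn_idr b :
  nu_map (arrow_conn b) ∘ nu_map (adc_tens_map (adc_id arrow) (arrow_end (~~ b))) =
  nu_map (adc_id arrow) ∘ nu_map (adc_runit arrow).
Proof.
apply: nu_map_tens_ext => n i [|j] h x y; last by rewrite (unit_grp0 y) tens0r !raddf0.
rewrite adc_tens_mapE arrow_connE.
have h' : i = n by rewrite -[i]addn0.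
subst i; rewrite adc_runitE.
case: n h x => [|[|n]] h x; last exact: rV0_eq.
  case: x => x1 x2; rewrite [RHS]pairMz.
  by case: b; congr pair => /=; lia.
rewrite [RHS](mulrzz x y).
by case: b; rewrite /= /arrow_vertex /=.
Qed.

Definition globe_end (e : bool) : ooFun (disk 0) (disk 1) :=
  if e then globe_tgt 0 else globe_src 0.

(** * The connections on [D_1] and their four faces *)

Section Connection.
Variable G : grayTensor.

Definition connection (b : bool) : ooFun (gt G (disk 1) (disk 1)) (disk 1) :=
  arrow_disk ∘ nu_map (arrow_conn b) ∘
  mu (gray_nu G) strong_Steiner_arrow strong_Steiner_arrow ∘
  gtm G disk_arrow disk_arrow.

Lemma disk_arrow_end e :
  disk_arrow ∘ globe_end e = nu_map (arrow_end e) ∘ mu_unit (gray_nu G).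
Proof.
apply: disk_ext; apply: arrow_tab_eq => e'.
have -> : (disk_arrow ∘ globe_end e) 0%N (disk_top 0) = bd e 0%N arrow_top.
  have ge : globe_end e 0%N (disk_top 0) = bd e 0%N (disk_top 1).
    by case: e; apply: disk_map_top.
  rewrite -[in RHS](disk_map_top arrow_top) -(fun_bd (disk_map arrow_top)) -ge.
  exact: erefl.
(* The constraint [mu_unit] is an arbitrary one, but the augmentation of the unit complex is the
   identity, so the degree 0 entries of the image of the point must be 1. *)
have /= -> := tab_aug (mu_unit (gray_nu G) 0%N (disk_top 0)) e'.
by case: e e' => [] [].
Qed.

(** [nu adc_unit] is isomorphic to [D_0], hence terminal, so the choice of [f] does not matter. *)
Lemma arrow_disk_end e (T : ooCat) (f : ooFun T (nu adc_unit)) :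
  arrow_disk ∘ nu_map (arrow_end e) ∘ f = globe_end e ∘ to_disk0 T.
Proof.
have [_ mK] := mu_unitK (gray_nu G).
rewrite -[nu_map (arrow_end e)]fcompid -mK (fcompA (nu_map _)) -disk_arrow_end.
rewrite !fcompA (proj1 disk_arrowK) fidcomp -!fcompA.
by congr (_ ∘ _); apply: to_disk0_uniq.
Qed.

(** Reduces a face of the connection to an identity between morphisms of complexes: naturality of
    [mu] moves the end inside the tensor product, and [mu_lun] then recovers the unit constraint. *)
Lemma connection_endl b e (F : ooFun (nu arrow) (nu arrow)) :
  nu_map (arrow_conn b) ∘ nu_map (adc_tens_map (arrow_end e) (adc_id arrow)) =
  F ∘ nu_map (adc_lunit arrow) ->
  connection b ∘ gtm G (globe_end e) (fid (disk 1)) =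
  arrow_disk ∘ F ∘ disk_arrow ∘ glun G (disk 1).
Proof.
move=> eF; rewrite /connection -(fcompA _ (gtm _ _ _)) gtm_fuse fcompid disk_arrow_end.
have -> : gtm G (nu_map (arrow_end e) ∘ mu_unit (gray_nu G)) disk_arrow =
    gtm G (nu_map (arrow_end e)) (nu_map (adc_id arrow)) ∘
    gtm G (mu_unit (gray_nu G)) (fid _) ∘ gtm G (fid _) disk_arrow.
  by rewrite !gtm_fuse nu_map_id !fcompid !fidcomp.
rewrite !fcompA -(fcompA _ (mu _ _ _)).
rewrite (mu_nat (gray_nu G) strong_Steiner_unit _ strong_Steiner_arrow).
rewrite (fcompA (_ ∘ _)) -(fcompA arrow_disk) eF.
rewrite -(fcompA _ _ (gtm _ _ (fid _))) -(fcompA arrow_disk) -(fcompA F).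
rewrite (fcompA (nu_map _) (mu _ _ _)) (mu_lun (gray_nu G)).
by rewrite (fcompA _ F) -(fcompA (arrow_disk ∘ F)) glun_nat !fcompA.
Qed.

Lemma connection_endr b e (F : ooFun (nu arrow) (nu arrow)) :
  nu_map (arrow_conn b) ∘ nu_map (adc_tens_map (adc_id arrow) (arrow_end e)) =
  F ∘ nu_map (adc_runit arrow) ->
  connection b ∘ gtm G (fid (disk 1)) (globe_end e) =
  arrow_disk ∘ F ∘ disk_arrow ∘ grun G (disk 1).
Proof.
move=> eF; rewrite /connection -(fcompA _ (gtm _ _ _)) gtm_fuse fcompid disk_arrow_end.
have -> : gtm G disk_arrow (nu_map (arrow_end e) ∘ mu_unit (gray_nu G)) =
    gtm G (nu_map (adc_id arrow)) (nu_map (arrow_end e)) ∘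
    gtm G (fid _) (mu_unit (gray_nu G)) ∘ gtm G disk_arrow (fid _).
  by rewrite !gtm_fuse nu_map_id !fcompid !fidcomp.
rewrite !fcompA -(fcompA _ (mu _ _ _)).
rewrite (mu_nat (gray_nu G) strong_Steiner_arrow _ strong_Steiner_unit).
rewrite (fcompA (_ ∘ _)) -(fcompA arrow_disk) eF.
rewrite -(fcompA _ _ (gtm _ (fid _) _)) -(fcompA arrow_disk) -(fcompA F).
rewrite (fcompA (nu_map _) (mu _ _ _)) (mu_run (gray_nu G)).
by rewrite (fcompA _ F) -(fcompA (arrow_disk ∘ F)) grun_nat !fcompA.
Qed.

Lemma connection_absl b :
  connection b ∘ gtm G (globe_end b) (fid (disk 1)) = globe_end b ∘ to_disk0 _.
Proof.
by rewrite (connection_endl (arrow_conn_absl b)) fcompA -!(fcompA (_ ∘ _)) arrow_disk_end.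
Qed.

Lemma connection_absr b :
  connection b ∘ gtm G (fid (disk 1)) (globe_end b) = globe_end b ∘ to_disk0 _.
Proof.
by rewrite (connection_endr (arrow_conn_absr b)) fcompA -!(fcompA (_ ∘ _)) arrow_disk_end.
Qed.

Lemma connection_idl b :
  connection b ∘ gtm G (globe_end (~~ b)) (fid (disk 1)) = glun G (disk 1).
Proof.
rewrite (connection_endl (arrow_conn_idl b)) nu_map_id fcompid.
by rewrite (proj1 disk_arrowK) fidcomp.
Qed.

Lemma connection_idr b :
  connection b ∘ gtm G (fid (disk 1)) (globe_end (~~ b)) = grun G (disk 1).
Proof.
rewrite (connection_endr (arrow_conn_idr b)) nu_map_id fcompid.
by rewrite (proj1 disk_arrowK) fidcomp.
Qed.

End Connection.

Local Close Scope ring_scope.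

(** * Cylinders, commas and slices *)

Section Cylinder.
Variable G : grayTensor.
Local Notation "'I⊗' A" := (gt G (disk 1) A) (at level 8, A at level 8).
Local Notation "'I⊗m' f" := (gtm G (fid (disk 1)) f) (at level 8, f at level 8).

(* Without a lock, unification unfolds the cylinder maps when rewriting with
   [fcompA]. *)
Fact cyl_key : unit. Proof. exact: tt. Qed.

Definition cyl_proj (A : ooCat) : ooFun (I⊗ A) A :=
  locked_with cyl_key (glun G A ∘ gtm G (to_disk0 (disk 1)) (fid A)).

Lemma cyl_projE A : cyl_proj A = glun G A ∘ gtm G (to_disk0 (disk 1)) (fid A).
Proof. exact: locked_withE. Qed.

Definition cyl_end (e : bool) (A : ooCat) : ooFun A (I⊗ A) :=
  locked_with cyl_key (gtm G (globe_end e) (fid A) ∘ glun_inv G A).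

Lemma cyl_endE e A :
  cyl_end e A = gtm G (globe_end e) (fid A) ∘ glun_inv G A.
Proof. exact: locked_withE. Qed.

Lemma tr_srcEnd A B (a : ooFun (I⊗ A) B) : tr_src a = a ∘ cyl_end false A.
Proof. by rewrite cyl_endE /tr_src -fcompA. Qed.

Lemma tr_tgtEnd A B (a : ooFun (I⊗ A) B) : tr_tgt a = a ∘ cyl_end true A.
Proof. by rewrite cyl_endE /tr_tgt -fcompA. Qed.

Lemma oplax_src A B (u v : ooFun A B) (a : oplax G u v) : tr a ∘ cyl_end false A = u.
Proof. by rewrite -tr_srcEnd tr_srcE. Qed.

Lemma oplax_tgt A B (u v : ooFun A B) (a : oplax G u v) : tr a ∘ cyl_end true A = v.
Proof. by rewrite -tr_tgtEnd tr_tgtE. Qed.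

Lemma cyl_fuse A B C (f : ooFun A B) (g : ooFun B C) :
  I⊗m g ∘ I⊗m f = I⊗m (g ∘ f).
Proof. by rewrite gtm_fuse fcompid. Qed.

Lemma cyl_proj_nat A B (f : ooFun A B) :
  cyl_proj B ∘ I⊗m f = f ∘ cyl_proj A.
Proof.
by rewrite !cyl_projE fcompA -glun_nat -!fcompA !gtm_fuse !fcompid !fidcomp.
Qed.

Lemma cyl_end_nat e A B (f : ooFun A B) :
  cyl_end e B ∘ f = I⊗m f ∘ cyl_end e A.
Proof.
rewrite !cyl_endE -!fcompA -glun_inv_nat !fcompA; congr (_ ∘ _).
by rewrite gtm_swap.
Qed.

Lemma cyl_proj_end e A : cyl_proj A ∘ cyl_end e A = fid A.
Proof.
rewrite !cyl_projE !cyl_endE fcompA -[_ ∘ _ ∘ gtm _ _ _]fcompA gtm_fuse fcompid.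
rewrite (to_disk0_uniq (_ ∘ _) (fid (disk 0))) gtm_id fcompid.
exact: (proj2 (glunK G A)).
Qed.

(** Under currying, both sides are the identity 1-cell of [cell0 u], that is, its restriction along
    the unique [D_1 -> D_0]. *)
Lemma tr_idE A B (u : ooFun A B) : tr (tr_id G u) = u ∘ cyl_proj A.
Proof.
apply: (can_inj (@cell1K G A B)); rewrite /= of_cell1K /cell1 !cyl_projE fcompA.
rewrite oplax_curry_nat /cell0 -fun_bd; congr (oplax_curry _ _ _ _).
rewrite -[LHS]disk_map_top.
by rewrite (to_disk0_uniq (disk_map _) (to_disk0 (disk 1))).
Qed.

(** Being an identity is stated on the underlying ∞-functor, because [u] and [v] may be different
    expressions for the same ∞-functor. *)
Lemma vcomp_idr A B (u v w : ooFun A B) (b : oplax G v w) (a : oplax G u v) :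
  tr a = v ∘ cyl_proj A -> tr (vcomp b a) = tr b.
Proof.
rewrite -tr_idE => ea /=.
apply: (can_inj (@cell1K G A B)); rewrite of_cell1K.
have E : cell1 a = bd false 1 (bd false 0 (cell1 b)).
  by rewrite ea /= of_cell1K bd_cell1 tr_srcE.
have h : composable 0 (cell1 b) (bd false 1 (bd false 0 (cell1 b))).
  by rewrite -E; apply: tr_composable.
by rewrite -[RHS](comp_idr h); apply: comp_congr.
Qed.

Definition cyl_conn (b : bool) (A : ooCat) : ooFun (I⊗ (I⊗ A)) (I⊗ A) :=
  locked_with cyl_key
    (gtm G (connection G b) (fid A) ∘ gassoc_inv G (disk 1) (disk 1) A).

Lemma cyl_connE b A : cyl_conn b A =
  gtm G (connection G b) (fid A) ∘ gassoc_inv G (disk 1) (disk 1) A.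
Proof. exact: locked_withE. Qed.

Lemma cyl_conn_nat b A B (f : ooFun A B) :
  cyl_conn b B ∘ I⊗m (I⊗m f) = I⊗m f ∘ cyl_conn b A.
Proof.
rewrite !cyl_connE -fcompA gassoc_inv_nat !fcompA !gtm_fuse gtm_id.
by rewrite !fcompid !fidcomp.
Qed.

(** Carries a face of [connection] over to cylinders. The outer end involves the left unit
    constraint of a tensor product, hence [glun_gassoc_inv]; the inner end, in [cyl_conn_endr], uses
    the triangle axiom through [grun_gassoc_inv]. *)
Lemma cyl_conn_endl b e A (f : ooFun (gt G (disk 0) (disk 1)) (disk 1)) :
  connection G b ∘ gtm G (globe_end e) (fid (disk 1)) = f ->
  cyl_conn b A ∘ cyl_end e (I⊗ A) =
  gtm G (f ∘ glun_inv G (disk 1)) (fid A).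
Proof.
move=> ef; rewrite !cyl_connE !cyl_endE -fcompA.
rewrite (fcompA (gassoc_inv _ _ _ _)) -[fid (I⊗ A)]gtm_id gassoc_inv_nat.
rewrite !fcompA gtm_fuse fcompid ef.
have {1}-> : f = f ∘ glun_inv G (disk 1) ∘ glun G (disk 1).
  by rewrite -fcompA (proj1 (glunK G _)) fcompid.
rewrite -[fid A]fcompid gtm_comp -!fcompA (fcompA (gtm _ (glun _ _) _)).
rewrite glun_gassoc_inv (proj2 (glunK G _)).
by rewrite !fcompid.
Qed.

Lemma cyl_conn_endr b e A (f : ooFun (gt G (disk 1) (disk 0)) (disk 1)) :
  connection G b ∘ gtm G (fid (disk 1)) (globe_end e) = f ->
  cyl_conn b A ∘ I⊗m (cyl_end e A) =
  gtm G (f ∘ grun_inv G (disk 1)) (fid A).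
Proof.
move=> ef; rewrite !cyl_connE !cyl_endE -cyl_fuse -fcompA.
rewrite (fcompA (gassoc_inv _ _ _ _)) gassoc_inv_nat.
rewrite !fcompA gtm_fuse fcompid ef.
have {1}-> : f = f ∘ grun_inv G (disk 1) ∘ grun G (disk 1).
  by rewrite -fcompA (proj1 (grunK G _)) fcompid.
rewrite -[fid A]fcompid gtm_comp -!fcompA (fcompA (gtm _ (grun _ _) _)).
rewrite grun_gassoc_inv cyl_fuse (proj2 (glunK G _)) gtm_id.
by rewrite !fcompid.
Qed.

Lemma cyl_end_proj e A (f : ooFun (disk 1) (disk 0)) :
  gtm G (globe_end e ∘ f) (fid A) = cyl_end e A ∘ cyl_proj A.
Proof.
rewrite (to_disk0_uniq f (to_disk0 _)) !cyl_endE !cyl_projE -fcompA.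
rewrite (fcompA (glun_inv _ _)) (proj1 (glunK G _)) fidcomp gtm_fuse.
by rewrite fcompid.
Qed.

Lemma cyl_conn_absl b A :
  cyl_conn b A ∘ cyl_end b (I⊗ A) = cyl_end b A ∘ cyl_proj A.
Proof. by rewrite (cyl_conn_endl _ (connection_absl G b)) -fcompA cyl_end_proj. Qed.

Lemma cyl_conn_absr b A :
  cyl_conn b A ∘ I⊗m (cyl_end b A) = cyl_end b A ∘ cyl_proj A.
Proof. by rewrite (cyl_conn_endr _ (connection_absr G b)) -fcompA cyl_end_proj. Qed.

Lemma cyl_conn_idl b A : cyl_conn b A ∘ cyl_end (~~ b) (I⊗ A) = fid (I⊗ A).
Proof.
by rewrite (cyl_conn_endl _ (connection_idl G b)) (proj2 (glunK G _)) gtm_id.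
Qed.

Lemma cyl_conn_idr b A : cyl_conn b A ∘ I⊗m (cyl_end (~~ b) A) = fid (I⊗ A).
Proof.
by rewrite (cyl_conn_endr _ (connection_idr G b)) (proj2 (grunK G _)) gtm_id.
Qed.

(** Up to reassociation, both sides collapse [D_1 ⊗ D_1] to the terminal [D_0]; [glun_gassoc_inv]
    lets this be done one coordinate at a time. *)
Lemma cyl_proj_conn b A : cyl_proj A ∘ cyl_conn b A = cyl_proj A ∘ cyl_proj (I⊗ A).
Proof.
rewrite {1}cyl_projE !cyl_connE -fcompA (fcompA (gtm _ _ _)) gtm_fuse fcompid.
pose t := to_disk0 (disk 1).
rewrite (to_disk0_uniq (_ ∘ _) (glun G (disk 0) ∘ gtm G t t)).
rewrite -[fid A]fcompid gtm_comp -fcompA -gassoc_inv_nat.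
rewrite (fcompA (gtm _ (glun _ _) _)) glun_gassoc_inv !cyl_projE -/t.
rewrite -!fcompA (fcompA (gtm _ t _) (glun _ _)) -glun_nat -(fcompA (glun _ _)).
by rewrite gtm_fuse fcompid fidcomp.
Qed.

Definition mk_oplax A B (u v : ooFun A B) (l : ooFun (I⊗ A) B)
    (lu : l ∘ cyl_end false A = u) (lv : l ∘ cyl_end true A = v) : oplax G u v :=
  Oplax (etrans (tr_srcEnd l) lu) (etrans (tr_tgtEnd l) lv).

(** * The comma [C ↓ w] and its projection to [B] *)

Section Comma.
Variables (B C : ooCat) (w : ooFun B C).

(** The component [x] of a triple is not stored: it is the source of the arrow, recovered by
    [comma_src]. *)
Definition comma : ooCat := fibprod (lax_tgt G C) w.

Definition comma_obj : ooFun comma B := fib_snd _ _.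

Definition comma_tr : ooFun (I⊗ comma) C := lax_uncurry (fib_fst (lax_tgt G C) w).

Definition comma_src : ooFun comma C := comma_tr ∘ cyl_end false comma.

Lemma comma_trT : comma_tr ∘ cyl_end true comma = w ∘ comma_obj.
Proof.
by rewrite /comma_tr lax_uncurryE -fcompA -cyl_end_nat fcompA -tr_tgtEnd [LHS]fib_sq.
Qed.

Definition comma_cell : oplax G comma_src (w ∘ comma_obj) :=
  mk_oplax erefl comma_trT.

Lemma comma_tr_comp T (F : ooFun T comma) :
  comma_tr ∘ I⊗m F = lax_uncurry (fib_fst (lax_tgt G C) w ∘ F).
Proof. by rewrite /comma_tr !lax_uncurryE -fcompA cyl_fuse. Qed.

Lemma comma_ext T (F F' : ooFun T comma) :
  comma_obj ∘ F = comma_obj ∘ F' -> comma_tr ∘ I⊗m F = comma_tr ∘ I⊗m F' ->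
  F = F'.
Proof.
move=> eo; rewrite !comma_tr_comp => /(can_inj (@lax_uncurryK _ G _ _ _)) et.
exact: fib_ext.
Qed.

Section Pair.
Variables (T : ooCat) (y : ooFun T B) (l : ooFun (I⊗ T) C).
Hypothesis ly : l ∘ cyl_end true T = w ∘ y.

Lemma comma_pair_subproof : lax_tgt G C ∘ lax_curry G l = w ∘ y.
Proof. by rewrite -tr_tgt_whisker -lax_uncurryE lax_curryK tr_tgtEnd. Qed.

Definition comma_pair : ooFun T comma := fib_pair comma_pair_subproof.

Lemma comma_obj_pair : comma_obj ∘ comma_pair = y.
Proof. exact: fib_snd_pair. Qed.

Lemma comma_tr_pair : comma_tr ∘ I⊗m comma_pair = l.
Proof. by rewrite comma_tr_comp fib_fst_pair lax_curryK. Qed.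

Lemma comma_src_pair : comma_src ∘ comma_pair = l ∘ cyl_end false T.
Proof. by rewrite /comma_src -fcompA cyl_end_nat fcompA comma_tr_pair. Qed.

End Pair.

Lemma comma_unit_subproof : w ∘ cyl_proj B ∘ cyl_end true B = w ∘ fid B.
Proof. by rewrite -fcompA cyl_proj_end. Qed.

Definition comma_unit : ooFun B comma := comma_pair comma_unit_subproof.

Lemma comma_homotopy_subproof :
  comma_tr ∘ cyl_conn true comma ∘ cyl_end true (I⊗ comma) =
  w ∘ (comma_obj ∘ cyl_proj comma).
Proof. by rewrite -fcompA cyl_conn_absl !fcompA comma_trT. Qed.

(** For an arrow [l : x -> w b], the square [(t, s) |-> l (max (t, s))], with [t] along the arrow
    and [s] the time: it is [l] at [s = 0] and the identity of [w b] at [s = 1], while the side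
    [t = 1] stays at [w b]. *)
Definition comma_homotopy : ooFun (I⊗ comma) comma :=
  comma_pair comma_homotopy_subproof.

Lemma comma_unit_retract : strong_right_retract G comma_unit.
Proof.
exists comma_obj; first exact: comma_obj_pair.
have src : comma_homotopy ∘ cyl_end false comma = fid comma.
  apply: comma_ext.
    by rewrite fcompA comma_obj_pair -fcompA cyl_proj_end.
  rewrite -cyl_fuse fcompA comma_tr_pair -fcompA (cyl_conn_idr true).
  by rewrite gtm_id.
have tgt : comma_homotopy ∘ cyl_end true comma = comma_unit ∘ comma_obj.
  apply: comma_ext.
    rewrite !fcompA !comma_obj_pair -fcompA cyl_proj_end.
    by rewrite fcompid fidcomp.
  rewrite -!cyl_fuse !fcompA !comma_tr_pair -!fcompA (cyl_conn_absr true).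
  by rewrite fcompA comma_trT -fcompA cyl_proj_nat.
(* On the image of [comma_unit] the arrow is degenerate, and reparametrizing it by max leaves it
   degenerate, by [cyl_proj_conn]. *)
exists (mk_oplax src tgt); rewrite tr_idE /=; apply: comma_ext.
  by rewrite !fcompA !comma_obj_pair -fcompA cyl_proj_nat fcompA comma_obj_pair.
rewrite -!cyl_fuse !fcompA !comma_tr_pair -!fcompA cyl_conn_nat fcompA.
by rewrite comma_tr_pair -fcompA cyl_proj_nat cyl_proj_conn.
Qed.

(** * The composition ∞-functor between slices and its section *)

Section SliceComma.
Variable c : C 0.

Local Notation slP := (slice G c comma_src).
Local Notation slB := (slice G c w).

Definition slice_comma_map : ooFun slP slB := slice_map comma_cell c.

Lemma slice_comma_map_obj :
  slice_obj G c w ∘ slice_comma_map = comma_obj ∘ slice_obj G c comma_src.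
Proof. exact: slice_obj_pair. Qed.

Lemma slice_comma_map_tr :
  tr (slice_tr G c w) ∘ I⊗m slice_comma_map =
  tr (vcomp (whisker comma_cell (slice_obj G c comma_src)) (slice_tr G c comma_src)).
Proof. exact: slice_tr_pair. Qed.

(** An arrow [c -> w b] of the slice, seen as an object of the comma with source [c]. *)
Definition slice_comma_sec_obj : ooFun slB comma :=
  comma_pair (oplax_tgt (slice_tr G c w)).

Lemma slice_comma_sec_src :
  fconst slB c ∘ cyl_proj slB ∘ cyl_end false slB = fconst slB c.
Proof. by rewrite -fcompA cyl_proj_end fcompid. Qed.

Lemma slice_comma_sec_tgt :
  fconst slB c ∘ cyl_proj slB ∘ cyl_end true slB = comma_src ∘ slice_comma_sec_obj.
Proof. by rewrite -fcompA cyl_proj_end fcompid comma_src_pair oplax_src. Qed.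

Definition slice_comma_sec : ooFun slB slP :=
  slice_pair (mk_oplax slice_comma_sec_src slice_comma_sec_tgt).

Lemma slice_comma_secK : slice_comma_map ∘ slice_comma_sec = fid slB.
Proof.
apply: slice_ext.
  rewrite fcompA slice_comma_map_obj -fcompA slice_obj_pair.
  by rewrite comma_obj_pair fcompid.
rewrite /= -cyl_fuse fcompA slice_comma_map_tr.
rewrite -[LHS]/(tr (whisker _ slice_comma_sec)) vcomp_whisker vcomp_idr.
  by rewrite /= -fcompA cyl_fuse slice_obj_pair comma_tr_pair gtm_id fcompid.
rewrite -[LHS]/(tr (whisker (slice_tr G c comma_src) _)) slice_tr_pair /=.
rewrite -(fcompA comma_src) slice_obj_pair comma_src_pair.
by rewrite (oplax_src (slice_tr G c w)).
Qed.

Local Notation z := (slice_obj G c comma_src).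
Local Notation kappa := (slice_tr G c comma_src).

Lemma slice_comma_src_subproof :
  tr kappa ∘ cyl_conn true slP ∘ cyl_end false (I⊗ slP) = tr kappa.
Proof. by rewrite -fcompA (cyl_conn_idl true) fcompid. Qed.

Lemma slice_comma_mid_subproof :
  tr kappa ∘ cyl_conn true slP ∘ cyl_end true (I⊗ slP) =
  comma_src ∘ (z ∘ cyl_proj slP).
Proof. by rewrite -fcompA cyl_conn_absl !fcompA (oplax_tgt kappa). Qed.

(* The triangle with vertices [c], [x], [w b] given by an object [c -> x -> w b]
   of the slice, seen as a square whose side [w b -> w b] is degenerate. *)
Definition slice_comma_square : oplax G (tr kappa) (w ∘ comma_obj ∘ (z ∘ cyl_proj slP)) :=
  vcomp (whisker comma_cell (z ∘ cyl_proj slP))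
    (mk_oplax slice_comma_src_subproof slice_comma_mid_subproof).

Lemma slice_comma_square_tgt :
  tr slice_comma_square ∘ cyl_end true (I⊗ slP) =
  w ∘ (comma_obj ∘ (z ∘ cyl_proj slP)).
Proof. exact: etrans (oplax_tgt slice_comma_square) (esym (fcompA _ _ _)). Qed.

(** At time [s] this is [(κ(s), b, κ(s) -> x -> w b)], where [κ : c -> x]; it moves from the
    composite [c -> w b] to the given [x -> w b]. *)
Definition slice_comma_htpy_obj : ooFun (I⊗ slP) comma :=
  comma_pair slice_comma_square_tgt.

Lemma slice_comma_htpy_src :
  tr kappa ∘ cyl_conn false slP ∘ cyl_end false (I⊗ slP) = fconst (I⊗ slP) c.
Proof.
by rewrite -fcompA (cyl_conn_absl false) fcompA (oplax_src kappa) fconst_comp.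
Qed.

Lemma slice_comma_htpy_tgt :
  tr kappa ∘ cyl_conn false slP ∘ cyl_end true (I⊗ slP) =
  comma_src ∘ slice_comma_htpy_obj.
Proof.
rewrite -fcompA (cyl_conn_idl false) fcompid comma_src_pair.
by rewrite (oplax_src slice_comma_square).
Qed.

(** The arrow from [c] to [κ(s)] is [t |-> κ(min (t, s))]: constant at time 0, all of [κ] at time
    1. *)
Definition slice_comma_htpy : ooFun (I⊗ slP) slP :=
  slice_pair (mk_oplax slice_comma_htpy_src slice_comma_htpy_tgt).

(** This and the next two lemmas compute the three components by which ∞-functors to [slP] are
    compared: the arrow from [c], the object [b] and the arrow to [w b]. *)
Lemma slice_comma_htpy_trE T (F : ooFun T (I⊗ slP)) :
  tr kappa ∘ I⊗m (slice_comma_htpy ∘ F) = tr kappa ∘ cyl_conn false slP ∘ I⊗m F.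
Proof.
rewrite -cyl_fuse fcompA; congr (_ ∘ _).
exact: slice_tr_pair.
Qed.

Lemma slice_comma_htpy_objE T (F : ooFun T (I⊗ slP)) :
  comma_obj ∘ (z ∘ (slice_comma_htpy ∘ F)) = comma_obj ∘ z ∘ cyl_proj slP ∘ F.
Proof. by rewrite !fcompA -(fcompA comma_obj) slice_obj_pair comma_obj_pair fcompA. Qed.

Lemma slice_comma_htpy_comma_trE T (F : ooFun T (I⊗ slP)) :
  comma_tr ∘ I⊗m (z ∘ (slice_comma_htpy ∘ F)) = tr (whisker slice_comma_square F).
Proof. by rewrite fcompA -cyl_fuse fcompA slice_obj_pair comma_tr_pair. Qed.

Lemma slice_comma_htpy_end0 :
  slice_comma_htpy ∘ cyl_end false slP = slice_comma_sec ∘ slice_comma_map.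
Proof.
apply: slice_ext; last first.
  rewrite [LHS]slice_comma_htpy_trE -fcompA (cyl_conn_absr false) fcompA (oplax_src kappa).
  rewrite /= -cyl_fuse fcompA.
  rewrite -[X in _ = X ∘ _]/(tr (whisker kappa slice_comma_sec)) slice_tr_pair /=.
  by rewrite -fcompA cyl_proj_nat fcompA !fconst_comp.
apply: comma_ext.
  rewrite slice_comma_htpy_objE -fcompA cyl_proj_end fcompid.
  by rewrite (fcompA z) slice_obj_pair fcompA comma_obj_pair slice_comma_map_obj.
rewrite (fcompA z slice_comma_sec) slice_obj_pair -(cyl_fuse slice_comma_map).
rewrite (fcompA comma_tr) comma_tr_pair.
rewrite slice_comma_map_tr slice_comma_htpy_comma_trE vcomp_whisker.
apply: vcomp_congr => /=.
  by rewrite -fcompA cyl_fuse -fcompA cyl_proj_end fcompid.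
by rewrite -fcompA (cyl_conn_idr true) fcompid.
Qed.

Lemma slice_comma_htpy_end1 : slice_comma_htpy ∘ cyl_end true slP = fid slP.
Proof.
apply: slice_ext; last first.
  rewrite [LHS]slice_comma_htpy_trE -fcompA (cyl_conn_idr false) /=.
  by rewrite gtm_id.
apply: comma_ext.
  by rewrite slice_comma_htpy_objE -fcompA cyl_proj_end !fcompid.
(* At time 1, [κ(max (t, 1))] is constant at [x], so the first leg of the composite is an
   identity. *)
rewrite slice_comma_htpy_comma_trE vcomp_whisker vcomp_idr /=.
  by rewrite -fcompA cyl_fuse -fcompA cyl_proj_end.
rewrite -fcompA (cyl_conn_absr true) fcompA (oplax_tgt kappa).
by rewrite -!fcompA (fcompA (cyl_proj _)) cyl_proj_end fidcomp.
Qed.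

(** Over the section [κ] is the identity of [c], so both connection squares degenerate and nothing
    moves. *)
Lemma slice_comma_htpy_sec :
  slice_comma_htpy ∘ I⊗m slice_comma_sec = slice_comma_sec ∘ cyl_proj slB.
Proof.
have kE : tr kappa ∘ I⊗m slice_comma_sec = fconst slB c ∘ cyl_proj slB.
  exact: slice_tr_pair.
apply: slice_ext; last first.
  rewrite [LHS]slice_comma_htpy_trE -fcompA cyl_conn_nat fcompA kE.
  by rewrite /= -cyl_fuse fcompA kE -!fcompA cyl_proj_nat cyl_proj_conn.
apply: comma_ext.
  rewrite slice_comma_htpy_objE -!fcompA cyl_proj_nat (fcompA z).
  by rewrite slice_obj_pair.
rewrite slice_comma_htpy_comma_trE vcomp_whisker vcomp_idr /=.
  rewrite -fcompA cyl_fuse -fcompA cyl_proj_nat.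
  by rewrite fcompA.
have -> : comma_src ∘ (z ∘ cyl_proj slP) ∘ I⊗m slice_comma_sec =
    fconst slB c ∘ cyl_proj slB.
  rewrite -(fcompA comma_src) -(fcompA z) cyl_proj_nat (fcompA z) slice_obj_pair.
  by rewrite (fcompA comma_src) comma_src_pair (oplax_src (slice_tr G c w)).
by rewrite -fcompA cyl_conn_nat fcompA kE -!(fcompA (fconst _ _)) cyl_proj_conn.
Qed.

Lemma slice_comma_sec_retract : strong_left_retract G slice_comma_sec.
Proof.
exists slice_comma_map; first exact: slice_comma_secK.
exists (mk_oplax slice_comma_htpy_end0 slice_comma_htpy_end1).
rewrite tr_idE; exact: slice_comma_htpy_sec.
Qed.

End SliceComma.

(** * The factorization of a 2-triangle through the comma *)

Section Triangle.
Variables (A : ooCat) (u : ooFun A B) (v : ooFun A C) (a : oplax G v (w ∘ u)).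

Definition comma_of : ooFun A comma := comma_pair (oplax_tgt a).

Lemma comma_of_src : comma_src ∘ comma_of = v.
Proof. by rewrite comma_src_pair oplax_src. Qed.

(** [slice_tri] keeps the arrow from [c], and [slice_comma_map] composes it with the arrow of the
    comma, which over [comma_of] is [a]. *)
Lemma slice_comma_of c :
  slice_comma_map c ∘ slice_tri G comma_of_src c = slice_map a c.
Proof.
apply: slice_ext.
  rewrite fcompA slice_comma_map_obj -fcompA !slice_obj_pair.
  by rewrite fcompA comma_obj_pair.
rewrite whisker_comp -[tr (whisker _ (slice_comma_map c))](esym (slice_comma_map_tr c)).
rewrite -[LHS]/(tr (whisker _ (slice_tri G comma_of_src c))) vcomp_whisker.
have e1 : tr (whisker (whisker comma_cell (slice_obj G c comma_src))
    (slice_tri G comma_of_src c)) = tr (whisker a (slice_obj G c v)).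
  by rewrite /= -!fcompA cyl_fuse slice_obj_pair -cyl_fuse fcompA comma_tr_pair.
have e2 : tr (whisker (slice_tr G c comma_src) (slice_tri G comma_of_src c)) =
    tr (slice_tr G c v) := slice_tr_pair _.
apply: etrans (esym (slice_tr_pair _)).
exact: (vcomp_congr e1 e2).
Qed.

End Triangle.

End Comma.

End Cylinder.

(** * Theorem A for 2-triangles *)

Theorem mainTheorem2
  (G : grayTensor)
  (W : forall A B : ooCat, ooFun A B -> Prop)
  (W_id : forall A : ooCat, W A A (fid A))
  (W_comp : forall (A B C : ooCat) (f : ooFun A B) (g : ooFun B C),
    W A B f -> W B C g -> W A C (g ∘ f))
  (W_cancel_l : forall (A B C : ooCat) (f : ooFun A B) (g : ooFun B C),
    W B C g -> W A C (g ∘ f) -> W A B f)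
  (W_cancel_r : forall (A B C : ooCat) (f : ooFun A B) (g : ooFun B C),
    W A B f -> W A C (g ∘ f) -> W B C g)
  (W_left_retract : forall (A B : ooCat) (i : ooFun A B),
    strong_left_retract G i -> W A B i)
  (W_right_retract : forall (A B : ooCat) (i : ooFun A B),
    strong_right_retract G i -> W A B i)
  (W_thmA : forall (A B C : ooCat)
      (u : ooFun A B) (v : ooFun A C) (w : ooFun B C) (e : w ∘ u = v),
    (forall c : C 0, W (slice G c v) (slice G c w) (slice_tri G e c)) ->
    W A B u) :
  forall (A B C : ooCat) (u : ooFun A B) (v : ooFun A C) (w : ooFun B C)
    (a : oplax G v (w ∘ u)),
    (forall c : C 0, W (slice G c v) (slice G c w) (slice_map a c)) ->
    W A B u.
Proof.
move=> A B C u v w a Wa.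
have Wq : W _ _ (comma_obj G w).
  apply: (W_cancel_r _ _ _ (comma_unit G w)).
    exact/W_right_retract/comma_unit_retract.
  by rewrite comma_obj_pair; apply: W_id.
(* Writes [u] as [comma_of] followed by the projection, already known to be in [W]. *)
rewrite -(comma_obj_pair (oplax_tgt a)); apply: W_comp => //.
apply: (W_thmA _ _ _ _ _ _ (comma_of_src a)) => c.
apply: (W_cancel_l _ _ _ _ (slice_comma_map G w c)); last first.
  by rewrite slice_comma_of.
apply: (W_cancel_r _ _ _ (slice_comma_sec G w c)).
  exact/W_left_retract/slice_comma_sec_retract.
by rewrite slice_comma_secK; apply: W_id.
Qed.
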